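(* Let $\mathcal{C}$ be a modular tensor category (not assumed semisimple) over an algebraically closed field $k$. Then the Lyubashenko invariant satisfies $\mathrm{Lyu}_\Lambda(S^2\times S^1,\emptyset)\neq0$ if and only if $\mathcal{C}$ is semisimple.
   Context: A finite tensor category is a $k$-linear abelian rigid monoidal category with bilinear $\otimes$, simple unit $\mathbf{1}$, finite-dimensional Hom-spaces, objects of finite length, finitely many simples up to isomorphism and enough projectives. Let $\mathcal{C}$ be a ribbon (hence braided, pivotal) finite tensor category with braiding $c$, twist $\theta$, and duality maps $\mathrm{ev}_X:X^\vee X\to\mathbf 1$, $\mathrm{coev}_X:\mathbf 1\to XX^\vee$, $\widetilde{\mathrm{ev}}_X$, $\widetilde{\mathrm{coev}}_X:\mathbf 1\to X^\vee X$. Coend: $\mathcal{L}=\int^{X}X^\vee\otimes X$ with universal dinatural maps $j_X:X^\vee\otimes X\to\mathcal{L}$. It is a Hopf algebra in $\mathcal{C}$: counit $\varepsilon_{\mathcal L}\circ j_X=\mathrm{ev}_X$, coproduct $\Delta_{\mathcal L}\circ j_X=(j_X\otimes j_X)(\mathrm{id}\otimes\mathrm{coev}_X\otimes\mathrm{id})$, unit $\eta_{\mathcal L}=j_{\mathbf 1}$, product $m_{\mathcal L}\circ(j_X\otimes j_Y)=j_{X\otimes Y}\circ(\text{canonical iso }Y^\vee X^\vee\cong(XY)^\vee)\circ(c_{X^\vee X,Y^\vee}\otimes\mathrm{id}_Y)$. The Hopf pairing $\omega_{\mathcal L}:\mathcal{L}\otimes\mathcal{L}\to\mathbf 1$ is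 given by $\omega_{\mathcal L}\circ(j_X\otimes j_Y)=(\mathrm{ev}_X\otimes\mathrm{ev}_Y)\circ(\mathrm{id}\otimes(c_{Y^\vee,X}\circ c_{X,Y^\vee})\otimes\mathrm{id})$. $\mathcal{C}$ is modular if $\omega_{\mathcal L}$ is non-degenerate. A modular category is unimodular, so there is a non-zero two-sided integral $\Lambda:\mathbf 1\to\mathcal{L}$, i.e. $m_{\mathcal L}(\Lambda\otimes\mathrm{id})=\Lambda\varepsilon_{\mathcal L}=m_{\mathcal L}(\mathrm{id}\otimes\Lambda)$, unique up to scalar; fix one. With $\mathcal{T}_{\mathcal L}\circ j_X=j_X\circ(\mathrm{id}\otimes\theta_X)$ put $\varepsilon_{\mathcal L}\mathcal{T}_{\mathcal L}^{\pm1}\Lambda=\Delta_\pm\mathrm{id}_{\mathbf 1}$; for modular $\mathcal{C}$ one has $\Delta_\pm\neq0$. Choose $\mathscr{D}$ with $\mathscr{D}^2=\Delta_+\Delta_-$ and set $\delta=\Delta_+/\mathscr{D}$. Lyubashenko invariant: let the closed connected oriented 3-manifold $M$ be obtained by surgery on a framed link $L\subset S^3$ with $n=\ell(L)$ components and signature $\sigma(L)$. For each component pull one edge down and cut it open, giving a graph with $n$ pairs of strands at the bottom so that closing these with cups recovers $L$; colouring the $i$-th component by $X_i\in\mathcal{C}$ and applying the Reshetikhin-Turaev functor gives maps $X_1^\vee X_1\cdots X_n^\vee X_n\to\mathbf 1$, dinatural in each $X_i$, hence a morphism $f_L:\mathcal{L}^{\otimes n}\to\mathbf 1$. Then $\mathrm{Lyu}_\Lambda(M,\emptyset)=\mathscr{D}^{-1-\ell(L)}\delta^{-\sigma(L)}\,f_L\circ\Lambda^{\otimes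 n}\in\mathrm{End}(\mathbf 1)=k$, a topological invariant of $M$. A surgery link for $S^2\times S^1$ is the zero-framed unknot. *)

(* Defs.v *)
From HB Require Import structures.
From mathcomp Require Import all_boot all_order all_algebra all_field.
From mathcomp Require Import boolp classical_sets.

Set Implicit Arguments.
Unset Strict Implicit.
Unset Printing Implicit Defensive.

Import Order.TTheory GRing.Theory Num.Theory.
Local Open Scope ring_scope.

(* Finite-dimensionality of the Hom-spaces is carried by vectType. *)
Record linearCategory (k : fieldType) := LinearCategory {
  ob :> Type;
  mor : ob -> ob -> vectType k;
  idm : forall X, mor X X;
  compm : forall X Y Z, mor Y Z -> mor X Y -> mor X Z;
  comp_idl : forall X Y (f : mor X Y), compm (idm Y) f = f;
  comp_idr : forall X Y (f : mor X Y), compm f (idm X) = f;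
  compA : forall W X Y Z (h : mor Y Z) (g : mor X Y) (f : mor W X),
    compm h (compm g f) = compm (compm h g) f;
  comp_linear_l : forall X Y Z (f : mor X Y),
    linear (fun g : mor Y Z => compm g f);
  comp_linear_r : forall X Y Z (g : mor Y Z),
    linear (fun f : mor X Y => compm g f)
}.

Declare Scope cat_scope.
Delimit Scope cat_scope with cat.
Open Scope cat_scope.

Notation "g ∘ f" := (compm g f) (at level 50, left associativity) : cat_scope.
Notation "'\id_' X" := (idm X) (at level 9, X at level 8, format "'\id_' X")
  : cat_scope.

Record iso (k : fieldType) (C : linearCategory k) (X Y : C) := Iso {
  fwd : mor X Y;
  bwd : mor Y X;
  fwdK : bwd ∘ fwd = \id_X;
  bwdK : fwd ∘ bwd = \id_Y
}.

Section Abelian.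
Variables (k : fieldType) (C : linearCategory k).
Implicit Types X Y Z : C.

Definition is_iso X Y (f : mor X Y) : Prop := exists i : iso X Y, fwd i = f.

Definition monic X Y (f : mor X Y) : Prop :=
  forall W (g h : mor W X), f ∘ g = f ∘ h -> g = h.

Definition epic X Y (f : mor X Y) : Prop :=
  forall Z (g h : mor Y Z), g ∘ f = h ∘ f -> g = h.

Definition is_zero X : Prop := \id_X = 0.

Definition is_kernel X Y K (f : mor X Y) (i : mor K X) : Prop :=
  f ∘ i = 0 /\
  forall W (g : mor W X), f ∘ g = 0 -> exists! h : mor W K, i ∘ h = g.

Definition is_cokernel X Y Q (f : mor X Y) (q : mor Y Q) : Prop :=
  q ∘ f = 0 /\
  forall Z (g : mor Y Z), g ∘ f = 0 -> exists! h : mor Q Z, h ∘ q = g.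

Definition is_direct_sum X n (S : 'I_n -> C) : Prop :=
  exists (i : forall a, mor (S a) X) (p : forall a, mor X (S a)),
    [/\ forall a, p a ∘ i a = \id_(S a),
        forall a b, a <> b -> p a ∘ i b = 0
      & \sum_(a < n) (i a ∘ p a) = \id_X].

Record abelian_category : Prop := AbelianCategory {
  direct_sum_ex : forall n (S : 'I_n -> C), exists X, is_direct_sum X S;
  kernel_ex : forall X Y (f : mor X Y), exists K (i : mor K X), is_kernel f i;
  cokernel_ex :
    forall X Y (f : mor X Y), exists Q (q : mor Y Q), is_cokernel f q;
  monic_normal : forall X Y (f : mor X Y), monic f ->
    exists Z (g : mor Y Z), is_kernel g f;
  epic_conormal : forall X Y (f : mor X Y), epic f ->
    exists W (g : mor W X), is_cokernel g f
}.

Definition simple_object X : Prop :=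
  ~ is_zero X /\
  forall Y (i : mor Y X), monic i -> is_zero Y \/ is_iso i.

Inductive finite_length : C -> Prop :=
| finite_length_zero X : is_zero X -> finite_length X
| finite_length_ext Y X Q (i : mor Y X) (q : mor X Q) :
    monic i -> is_cokernel i q -> simple_object Q ->
    finite_length Y -> finite_length X.

Definition projective P : Prop :=
  forall X Y (e : mor X Y) (f : mor P Y), epic e ->
    exists g : mor P X, e ∘ g = f.

Record finite_category : Prop := FiniteCategory {
  finite_abelian : abelian_category;
  finite_lengths : forall X, finite_length X;
  finitely_many_simples : exists n (S : 'I_n -> C),
    forall X, simple_object X -> exists a, inhabited (iso X (S a));
  enough_projectives :
    forall X, exists P (e : mor P X), projective P /\ epic e
}.

Definition semisimple_category : Prop :=
  forall X, exists n (S : 'I_n -> C),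
    (forall a, simple_object (S a)) /\ is_direct_sum X S.

End Abelian.

Reserved Notation "f ⊗m g" (at level 40, left associativity).

Record monoidalCategory (k : fieldType) := MonoidalCategory {
  underlying :> linearCategory k;
  tens : underlying -> underlying -> underlying;
  tensm : forall X X' Y Y' : underlying,
    mor X X' -> mor Y Y' -> mor (tens X Y) (tens X' Y');
  tunit : underlying;
  assoc : forall X Y Z, iso (tens (tens X Y) Z) (tens X (tens Y Z));
  lunit : forall X, iso (tens tunit X) X;
  runit : forall X, iso (tens X tunit) X;
  tensm_linear_l : forall (X X' Y Y' : underlying) (g : mor Y Y'),
    linear (fun f : mor X X' => tensm f g);
  tensm_linear_r : forall (X X' Y Y' : underlying) (f : mor X X'),
    linear (fun g : mor Y Y' => tensm f g);
  tensm_id : forall X Y, tensm \id_X \id_Y = \id_(tens X Y);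
  tensm_comp : forall X X' X'' Y Y' Y''
    (f' : mor X' X'') (f : mor X X') (g' : mor Y' Y'') (g : mor Y Y'),
    tensm (f' ∘ f) (g' ∘ g) = tensm f' g' ∘ tensm f g;
  assoc_nat : forall X X' Y Y' Z Z'
    (f : mor X X') (g : mor Y Y') (h : mor Z Z'),
    fwd (assoc X' Y' Z') ∘ tensm (tensm f g) h
    = tensm f (tensm g h) ∘ fwd (assoc X Y Z);
  lunit_nat : forall X X' (f : mor X X'),
    fwd (lunit X') ∘ tensm \id_tunit f = f ∘ fwd (lunit X);
  runit_nat : forall X X' (f : mor X X'),
    fwd (runit X') ∘ tensm f \id_tunit = f ∘ fwd (runit X);
  pentagon : forall W X Y Z,
    fwd (assoc W X (tens Y Z)) ∘ fwd (assoc (tens W X) Y Z)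
    = tensm \id_W (fwd (assoc X Y Z)) ∘ fwd (assoc W (tens X Y) Z)
      ∘ tensm (fwd (assoc W X Y)) \id_Z;
  triangle : forall X Y,
    tensm \id_X (fwd (lunit Y)) ∘ fwd (assoc X tunit Y)
    = tensm (fwd (runit X)) \id_Y
}.

Notation "X ⊗ Y" := (tens X Y) (at level 40, left associativity) : cat_scope.
Notation "f ⊗m g" := (tensm f g) : cat_scope.
Notation "𝟙" := (tunit _) : cat_scope.

(* Only left duals are listed: in a ribbon category the left dual is also a
   right dual, via [evt] and [coevt] below. *)
Record rigidCategory (k : fieldType) := RigidCategory {
  rigid_monoidal :> monoidalCategory k;
  ldual : rigid_monoidal -> rigid_monoidal;
  ev : forall X, mor (ldual X ⊗ X) 𝟙;
  coev : forall X, mor 𝟙 (X ⊗ ldual X);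
  zigzag : forall X,
    fwd (runit X) ∘ (\id_X ⊗m ev X) ∘ fwd (assoc X (ldual X) X)
      ∘ (coev X ⊗m \id_X) ∘ bwd (lunit X) = \id_X;
  zigzag_dual : forall X,
    fwd (lunit (ldual X)) ∘ (ev X ⊗m \id_(ldual X))
      ∘ bwd (assoc (ldual X) X (ldual X))
      ∘ (\id_(ldual X) ⊗m coev X) ∘ bwd (runit (ldual X)) = \id_(ldual X)
}.

Section Duals.
Variables (k : fieldType) (C : rigidCategory k).
Implicit Types V W X Y : C.

(* The morphism W -> V^∨ corresponding to a pairing W ⊗ V -> 1. *)
Definition mate W V (p : mor (W ⊗ V) 𝟙) : mor W (ldual V) :=
  fwd (lunit (ldual V)) ∘ (p ⊗m \id_(ldual V)) ∘ bwd (assoc W V (ldual V))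
    ∘ (\id_W ⊗m coev V) ∘ bwd (runit W).

Definition dualm X Y (f : mor X Y) : mor (ldual Y) (ldual X) :=
  mate (ev Y ∘ (\id_(ldual Y) ⊗m f)).

(* The canonical isomorphism Y^∨ ⊗ X^∨ -> (X ⊗ Y)^∨. *)
Definition dual_tens X Y : mor (ldual Y ⊗ ldual X) (ldual (X ⊗ Y)) :=
  mate (ev Y
        ∘ (\id_(ldual Y) ⊗m (fwd (lunit Y) ∘ (ev X ⊗m \id_Y)
                             ∘ bwd (assoc (ldual X) X Y)))
        ∘ fwd (assoc (ldual Y) (ldual X) (X ⊗ Y))).

End Duals.

Record ribbonCategory (k : fieldType) := RibbonCategory {
  ribbon_rigid :> rigidCategory k;
  braid : forall X Y : ribbon_rigid, iso (X ⊗ Y) (Y ⊗ X);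
  twist : forall X : ribbon_rigid, iso X X;
  braid_nat : forall (X X' Y Y' : ribbon_rigid) (f : mor X X') (g : mor Y Y'),
    fwd (braid X' Y') ∘ (f ⊗m g) = (g ⊗m f) ∘ fwd (braid X Y);
  hexagon_r : forall X Y Z,
    fwd (assoc Y Z X) ∘ fwd (braid X (Y ⊗ Z)) ∘ fwd (assoc X Y Z)
    = (\id_Y ⊗m fwd (braid X Z)) ∘ fwd (assoc Y X Z)
      ∘ (fwd (braid X Y) ⊗m \id_Z);
  hexagon_l : forall X Y Z,
    bwd (assoc Z X Y) ∘ fwd (braid (X ⊗ Y) Z) ∘ bwd (assoc X Y Z)
    = (fwd (braid X Z) ⊗m \id_Y) ∘ bwd (assoc X Z Y)
      ∘ (\id_X ⊗m fwd (braid Y Z));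
  twist_nat : forall (X Y : ribbon_rigid) (f : mor X Y),
    fwd (twist Y) ∘ f = f ∘ fwd (twist X);
  twist_tens : forall X Y,
    fwd (twist (X ⊗ Y))
    = fwd (braid Y X) ∘ fwd (braid X Y) ∘ (fwd (twist X) ⊗m fwd (twist Y));
  twist_dual : forall X, fwd (twist (ldual X)) = dualm (fwd (twist X))
}.

Definition finite_tensor_category (k : fieldType) (C : monoidalCategory k) :
  Prop := finite_category C /\ simple_object (𝟙 : C).

Section Ribbon.
Variables (k : fieldType) (C : ribbonCategory k).
Implicit Types V W X Y : C.

(* The right duality maps determined by the braiding and the twist, i.e. the
   pivotal structure of C. *)
Definition evt X : mor (X ⊗ ldual X) 𝟙 :=
  ev X ∘ fwd (braid X (ldual X)) ∘ (fwd (twist X) ⊗m \id_(ldual X)).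

Definition coevt X : mor 𝟙 (ldual X ⊗ X) :=
  (\id_(ldual X) ⊗m fwd (twist X)) ∘ fwd (braid X (ldual X)) ∘ coev X.

Definition dinatural V (phi : forall X, mor (ldual X ⊗ X) V) : Prop :=
  forall X Y (f : mor X Y),
    phi X ∘ (dualm f ⊗m \id_X) = phi Y ∘ (\id_(ldual Y) ⊗m f).

(* (X^∨ X)(Y^∨ Y) -> (Y^∨ X^∨)(X Y), given by c_{X^∨ X, Y^∨} ⊗ id_Y *)
Definition coend_shuffle X Y :
  mor ((ldual X ⊗ X) ⊗ (ldual Y ⊗ Y)) ((ldual Y ⊗ ldual X) ⊗ (X ⊗ Y)) :=
  fwd (assoc (ldual Y ⊗ ldual X) X Y)
    ∘ (bwd (assoc (ldual Y) (ldual X) X) ⊗m \id_Y)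
    ∘ (fwd (braid (ldual X ⊗ X) (ldual Y)) ⊗m \id_Y)
    ∘ bwd (assoc (ldual X ⊗ X) (ldual Y) Y).

(* id ⊗ (c_{Y^∨, X} ∘ c_{X, Y^∨}) ⊗ id on (X^∨ X)(Y^∨ Y) *)
Definition coend_monodromy X Y :
  mor ((ldual X ⊗ X) ⊗ (ldual Y ⊗ Y)) ((ldual X ⊗ X) ⊗ (ldual Y ⊗ Y)) :=
  bwd (assoc (ldual X) X (ldual Y ⊗ Y))
    ∘ (\id_(ldual X) ⊗m
        (fwd (assoc X (ldual Y) Y)
         ∘ ((fwd (braid (ldual Y) X) ∘ fwd (braid X (ldual Y))) ⊗m \id_Y)
         ∘ bwd (assoc X (ldual Y) Y)))
    ∘ fwd (assoc (ldual X) X (ldual Y ⊗ Y)).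

(* The coend together with those of its structure morphisms that are used
   below; each of them is uniquely determined by the stated equation. *)
Record coend := Coend {
  cobj :> C;
  cj : forall X, mor (ldual X ⊗ X) cobj;
  cj_dinatural : dinatural cj;
  cj_universal : forall V (phi : forall X, mor (ldual X ⊗ X) V),
    dinatural phi -> exists! f : mor cobj V, forall X, f ∘ cj X = phi X;
  ccounit : mor cobj 𝟙;
  ccounitE : forall X, ccounit ∘ cj X = ev X;
  cmul : mor (cobj ⊗ cobj) cobj;
  cmulE : forall X Y,
    cmul ∘ (cj X ⊗m cj Y)
    = cj (X ⊗ Y) ∘ (dual_tens X Y ⊗m \id_(X ⊗ Y)) ∘ coend_shuffle X Y;
  cpairing : mor (cobj ⊗ cobj) 𝟙;
  cpairingE : forall X Y,
    cpairing ∘ (cj X ⊗m cj Y)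
    = fwd (lunit 𝟙) ∘ (ev X ⊗m ev Y) ∘ coend_monodromy X Y;
  ctwist : iso cobj cobj;
  ctwistE : forall X,
    fwd ctwist ∘ cj X = cj X ∘ (\id_(ldual X) ⊗m fwd (twist X))
}.

Definition nondegenerate_pairing X (p : mor (X ⊗ X) 𝟙) : Prop := is_iso (mate p).

Definition two_sided_integral (L : coend) (Lam : mor 𝟙 L) : Prop :=
  cmul L ∘ (Lam ⊗m \id_L) = Lam ∘ ccounit L ∘ fwd (lunit (L : C)) /\
  cmul L ∘ (\id_L ⊗m Lam) = Lam ∘ ccounit L ∘ fwd (runit (L : C)).

End Ribbon.

(* Bracketed words of oriented strands. [Strand i true] is a strand coloured by
   the i-th colour X_i and [Strand i false] one coloured by X_i^∨. *)
Inductive word :=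
| Empty
| Strand (i : nat) (s : bool)
| Juxt (a b : word).

(* Diagrams of framed (blackboard framing) oriented tangles, read from bottom
   to top. *)
Inductive tangle : word -> word -> Type :=
| Tid a : tangle a a
| Tcomp a b c : tangle b c -> tangle a b -> tangle a c
| Tjuxt a a' b b' : tangle a a' -> tangle b b' -> tangle (Juxt a b) (Juxt a' b')
| Tassoc a b c : tangle (Juxt (Juxt a b) c) (Juxt a (Juxt b c))
| Tassoc_inv a b c : tangle (Juxt a (Juxt b c)) (Juxt (Juxt a b) c)
| Tlunit a : tangle (Juxt Empty a) a
| Tlunit_inv a : tangle a (Juxt Empty a)
| Trunit a : tangle (Juxt a Empty) a
| Trunit_inv a : tangle a (Juxt a Empty)
| Tcross i s j t :
    tangle (Juxt (Strand i s) (Strand j t)) (Juxt (Strand j t) (Strand i s))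
| Tcross_inv i s j t :
    tangle (Juxt (Strand j t) (Strand i s)) (Juxt (Strand i s) (Strand j t))
| Tev i : tangle (Juxt (Strand i false) (Strand i true)) Empty
| Tcoev i : tangle Empty (Juxt (Strand i true) (Strand i false))
| Tevt i : tangle (Juxt (Strand i true) (Strand i false)) Empty
| Tcoevt i : tangle Empty (Juxt (Strand i false) (Strand i true)).

(* n pairs of strands, coloured X_m^∨ X_m, X_(m+1)^∨ X_(m+1), and so on *)
Fixpoint bottom_from (m n : nat) : word :=
  if n is n'.+1 then
    Juxt (Juxt (Strand m false) (Strand m true)) (bottom_from m.+1 n')
  else Empty.

Definition bottom (n : nat) : word := bottom_from 0 n.

(* State sum over the labellings of the connected components of a diagram by
   booleans: with the labels of the end points prescribed consistently, its
   value is 2 ^ (number of closed components). *)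
Fixpoint labelling (a : word) : finType :=
  match a with
  | Empty => unit
  | Strand _ _ => bool
  | Juxt a b => (labelling a * labelling b)%type
  end.

Fixpoint true_labelling (a : word) : labelling a :=
  match a return labelling a with
  | Empty => tt
  | Strand _ _ => true
  | Juxt a b => (true_labelling a, true_labelling b)
  end.

Fixpoint states a b (T : tangle a b) : labelling a -> labelling b -> nat :=
  match T in tangle a b return labelling a -> labelling b -> nat with
  | Tid a => fun x y => (x == y : nat)
  | Tcomp a b c T2 T1 =>
      fun x z => (\sum_(y : labelling b) states T1 x y * states T2 y z)%N
  | Tjuxt _ _ _ _ T1 T2 =>
      fun x y => (states T1 x.1 y.1 * states T2 x.2 y.2)%N
  | Tassoc _ _ _ => fun x y => ((x.1.1, (x.1.2, x.2)) == y : nat)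
  | Tassoc_inv _ _ _ => fun x y => (((x.1, x.2.1), x.2.2) == y : nat)
  | Tlunit _ => fun x y => (x.2 == y : nat)
  | Tlunit_inv _ => fun x y => (x == y.2 : nat)
  | Trunit _ => fun x y => (x.1 == y : nat)
  | Trunit_inv _ => fun x y => (x == y.1 : nat)
  | Tcross _ _ _ _ => fun x y => ((x.2, x.1) == y : nat)
  | Tcross_inv _ _ _ _ => fun x y => ((x.2, x.1) == y : nat)
  | Tev _ => fun x _ => (x.1 == x.2 : nat)
  | Tcoev _ => fun _ y => (y.1 == y.2 : nat)
  | Tevt _ => fun x _ => (x.1 == x.2 : nat)
  | Tcoevt _ => fun _ y => (y.1 == y.2 : nat)
  end.

(* A framed link cut open once along each of its components: closing the
   bottom of [diagram] with the cups [Tcoevt 0], ..., [Tcoevt (ncomp - 1)]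
   gives back the link, whose i-th component is the one labelled i. *)
Record openedLink := OpenedLink {
  ncomp : nat;
  diagram : tangle (bottom ncomp) Empty;
  no_closed_component : states diagram (true_labelling _) tt = 1%N
}.

(* Sum of the signs of the crossings Tcross^{±1} of type (i, j). The crossing
   is positive when both strands point in the same vertical direction, so that
   a positive kink represents the twist. *)
Fixpoint crossings a b (T : tangle a b) (i j : nat) : int :=
  match T with
  | Tcomp _ _ _ T2 T1 => crossings T1 i j + crossings T2 i j
  | Tjuxt _ _ _ _ T1 T2 => crossings T1 i j + crossings T2 i j
  | Tcross i' s j' t =>
      if (i == i') && (j == j') then (if s == t then 1 else -1) else 0
  | Tcross_inv i' s j' t =>
      if (i == i') && (j == j') then (if s == t then -1 else 1) else 0
  | _ => 0
  end.

(* Diagonal entries are the framings (writhes); off the diagonal one gets half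
   the signed number of crossings between the two components. *)
Definition linking_matrix (L : openedLink) : 'M[rat]_(ncomp L) :=
  \matrix_(i, j)
    ((crossings (diagram L) i j + crossings (diagram L) j i)%:~R / 2%:R).

(* Number of positive minus number of negative eigenvalues. *)
Definition mx_signature n (A : 'M[rat]_n) : int :=
  \sum_(a <- sval (closed_field_poly_normal
                     (char_poly (map_mx ratr A : 'M[algC]_n)))) sgz a.

Definition link_signature (L : openedLink) : int :=
  mx_signature (linking_matrix L).

Section Lyubashenko.
Variables (k : fieldType) (C : ribbonCategory k).

Fixpoint rt_ob (X : nat -> C) (a : word) : C :=
  match a with
  | Empty => 𝟙
  | Strand i s => if s then X i else ldual (X i)
  | Juxt a b => rt_ob X a ⊗ rt_ob X b
  end.

Fixpoint rt (X : nat -> C) a b (T : tangle a b) :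
    mor (rt_ob X a) (rt_ob X b) :=
  match T in tangle a b return mor (rt_ob X a) (rt_ob X b) with
  | Tid a => \id_(rt_ob X a)
  | Tcomp _ _ _ T2 T1 => rt X T2 ∘ rt X T1
  | Tjuxt _ _ _ _ T1 T2 => rt X T1 ⊗m rt X T2
  | Tassoc a b c => fwd (assoc (rt_ob X a) (rt_ob X b) (rt_ob X c))
  | Tassoc_inv a b c => bwd (assoc (rt_ob X a) (rt_ob X b) (rt_ob X c))
  | Tlunit a => fwd (lunit (rt_ob X a))
  | Tlunit_inv a => bwd (lunit (rt_ob X a))
  | Trunit a => fwd (runit (rt_ob X a))
  | Trunit_inv a => bwd (runit (rt_ob X a))
  | Tcross i s j t =>
      fwd (braid (rt_ob X (Strand i s)) (rt_ob X (Strand j t)))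
  | Tcross_inv i s j t =>
      bwd (braid (rt_ob X (Strand i s)) (rt_ob X (Strand j t)))
  | Tev i => ev (X i)
  | Tcoev i => coev (X i)
  | Tevt i => evt (X i)
  | Tcoevt i => coevt (X i)
  end.

Variable L : coend C.

Fixpoint coend_pow (n : nat) : C :=
  if n is n'.+1 then cobj L ⊗ coend_pow n' else 𝟙.

(* j_{X_m} ⊗ ... ⊗ j_{X_(m+n-1)} *)
Fixpoint cj_pow (X : nat -> C) (m n : nat) :
    mor (rt_ob X (bottom_from m n)) (coend_pow n) :=
  match n return mor (rt_ob X (bottom_from m n)) (coend_pow n) with
  | 0 => \id_𝟙
  | n'.+1 => cj L (X m) ⊗m cj_pow X m.+1 n'
  end.

Fixpoint integral_pow (Lam : mor 𝟙 L) (n : nat) : mor 𝟙 (coend_pow n) :=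
  match n return mor 𝟙 (coend_pow n) with
  | 0 => \id_𝟙
  | n'.+1 => (Lam ⊗m integral_pow Lam n') ∘ bwd (lunit 𝟙)
  end.

(* The morphism f_K : L^{⊗ n} -> 1 through which the dinatural family of the
   Reshetikhin-Turaev evaluations of the opened link factors. *)
Definition link_morphism (K : openedLink) : mor (coend_pow (ncomp K)) 𝟙 :=
  xget 0 [set f | forall X : nat -> C,
                    f ∘ cj_pow X 0 (ncomp K) = rt X (diagram K)].

(* The invariant of the closed 3-manifold presented by surgery on K, where D is
   the chosen square root and delta = Delta_+ / D. *)
Definition lyubashenko (Lam : mor 𝟙 L) (D delta : k) (K : openedLink) :
    mor (𝟙 : C) 𝟙 :=
  (D ^- (ncomp K).+1 * delta ^ (- link_signature K))
    *: (link_morphism K ∘ integral_pow Lam (ncomp K)).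

End Lyubashenko.

Definition unknot_diagram : tangle (bottom 1) Empty :=
  Tcomp (Tev 0) (Trunit _).

Lemma unknot_no_closed_component :
  states unknot_diagram (true_labelling _) tt = 1%N.
Proof.
rewrite /= (bigD1 (true, true)) //= big1 ?addn0 // => -[x y] /= nxy.
by case: eqP => [e|//]; rewrite -e eqxx in nxy.
Qed.

(* The zero-framed unknot, a surgery link for S^2 x S^1. *)
Definition S2xS1 : openedLink := OpenedLink unknot_no_closed_component.

(* Main.v *)
From HB Require Import structures.
From mathcomp Require Import all_boot all_order all_algebra.
From mathcomp Require Import boolp classical_sets.
Require Import Defs.

(* Let Q be the natural endomorphism of the identity functor obtained by
   encircling a strand with a loop coloured by the integral Lam, so that up to a
   non-zero factor the invariant of S^2 x S^1 is counit o Lam, i.e. the value of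
   Q at the unit object. Sliding an X-coloured strand through the loop shows
   that the image of Q is transparent, and non-degeneracy of the pairing turns
   this into: phi o (id (x) Q) = tau o ev o (id (x) Q) for every dinatural phi,
   with tau the value of phi on the unit. The same slide through a loop of
   framing +-1 gives (loop) o theta^{+-1} = Delta_{+-} id, so that Delta_{+-} is
   not 0.

   If Q is not 0 on the unit, it is idempotent up to a scalar. Let G be a
   projective generator and A = End G. Pairing a minimal left ideal of A inside
   A Q with its dual right module, realised as Hom (G, S) for a simple S, gives
   a dinatural phi for which phi_G = sum_i d_i^* (x) v_i with v_i : G -> S. The
   identity above then makes Q_G factor through a power of S, so the unit is a
   direct summand of G, hence projective, hence every object is projective.

   If C is semisimple, Q is not 0 on some simple object S, and the identity
   above, applied to the projection onto the isotypic part of the unit, forces S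
   to be the unit. *)

Set Implicit Arguments.
Unset Strict Implicit.
Unset Printing Implicit Defensive.
Import GRing.Theory VectorInternalTheory.
Local Open Scope ring_scope.
Local Open Scope cat_scope.

Local Notation "X ◁ f" := (tensm (idm X) f)
  (at level 37, right associativity) : cat_scope.
Local Notation "f ▷ X" := (tensm f (idm X))
  (at level 39, left associativity) : cat_scope.
Local Notation α X Y Z := (fwd (assoc X Y Z)).
Local Notation α' X Y Z := (bwd (assoc X Y Z)).
Local Notation lu X := (fwd (lunit X)).
Local Notation lu' X := (bwd (lunit X)).
Local Notation ru X := (fwd (runit X)).
Local Notation ru' X := (bwd (runit X)).

(** * Bilinearity of composition and cancellation of isomorphisms *)

Section Linear.
Variables (k : fieldType) (C : linearCategory k).
Implicit Types X Y Z : C.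

(** Composites are kept bracketed to the left; this form applies an equation for two adjacent
    factors in the middle of such a chain. *)
Lemma comp2 W X Y Z (g : mor X Y) (f : mor W X) e :
  g ∘ f = e -> forall h : mor Y Z, h ∘ g ∘ f = h ∘ e.
Proof. by move=> <- h; rewrite compA. Qed.

Lemma comp3 V W X Y Z (g : mor X Y) (f : mor W X) (e : mor V W) d :
  g ∘ f ∘ e = d -> forall h : mor Y Z, h ∘ g ∘ f ∘ e = h ∘ d.
Proof. by move=> <- h; rewrite !compA. Qed.

Lemma comp0l X Y Z (f : mor X Y) : (0 : mor Y Z) ∘ f = 0.
Proof.
have := comp_linear_l f (-1) (0 : mor Y Z) 0.
by rewrite scaleN1r oppr0 add0r scaleN1r addNr.
Qed.

Lemma comp0r X Y Z (g : mor Y Z) : g ∘ (0 : mor X Y) = 0.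
Proof.
have := comp_linear_r g (-1) (0 : mor X Y) 0.
by rewrite scaleN1r oppr0 add0r scaleN1r addNr.
Qed.

Lemma compZl X Y Z c (g : mor Y Z) (f : mor X Y) :
  (c *: g) ∘ f = c *: (g ∘ f).
Proof. by have := comp_linear_l f c g 0; rewrite comp0l !addr0. Qed.

Lemma compZr X Y Z c (g : mor Y Z) (f : mor X Y) :
  g ∘ (c *: f) = c *: (g ∘ f).
Proof. by have := comp_linear_r g c f 0; rewrite comp0r !addr0. Qed.

Lemma compDl X Y Z (g h : mor Y Z) (f : mor X Y) :
  (g + h) ∘ f = (g ∘ f) + (h ∘ f).
Proof. by have := comp_linear_l f 1 g h; rewrite !scale1r. Qed.

Lemma compDr X Y Z (g : mor Y Z) (f h : mor X Y) :
  g ∘ (f + h) = (g ∘ f) + (g ∘ h).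
Proof. by have := comp_linear_r g 1 f h; rewrite !scale1r. Qed.

Lemma compBl X Y Z (g h : mor Y Z) (f : mor X Y) :
  (g - h) ∘ f = (g ∘ f) - (h ∘ f).
Proof. by rewrite compDl -scaleN1r compZl scaleN1r. Qed.

Lemma compBr X Y Z (g : mor Y Z) (f h : mor X Y) :
  g ∘ (f - h) = (g ∘ f) - (g ∘ h).
Proof. by rewrite compDr -scaleN1r compZr scaleN1r. Qed.

Lemma comp_suml X Y Z (I : finType) (P : pred I) (g : I -> mor Y Z)
    (f : mor X Y) :
  (\sum_(i | P i) g i) ∘ f = \sum_(i | P i) (g i ∘ f).
Proof.
by apply: (big_morph (fun g => g ∘ f)) => [u v|]; rewrite ?compDl ?comp0l.
Qed.

Lemma comp_sumr X Y Z (I : finType) (P : pred I) (g : mor Y Z)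
    (f : I -> mor X Y) :
  g ∘ (\sum_(i | P i) f i) = \sum_(i | P i) (g ∘ f i).
Proof.
by apply: (big_morph (fun f => g ∘ f)) => [u v|]; rewrite ?compDr ?comp0r.
Qed.

Lemma iso_epi X Y (i : iso X Y) : epic (fwd i).
Proof.
by move=> Z g h e; rewrite -[g]comp_idr -[h]comp_idr -(bwdK i) !compA e.
Qed.

Lemma iso_epi' X Y (i : iso X Y) : epic (bwd i).
Proof.
by move=> Z g h e; rewrite -[g]comp_idr -[h]comp_idr -(fwdK i) !compA e.
Qed.

Lemma iso_mono X Y (i : iso X Y) : monic (fwd i).
Proof.
by move=> Z g h e; rewrite -[g]comp_idl -[h]comp_idl -(fwdK i) -!compA e.
Qed.

Lemma iso_mono' X Y (i : iso X Y) : monic (bwd i).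
Proof.
by move=> Z g h e; rewrite -[g]comp_idl -[h]comp_idl -(bwdK i) -!compA e.
Qed.

Lemma fwdKr X Y Z (i : iso X Y) (f : mor X Z) : f ∘ bwd i ∘ fwd i = f.
Proof. by rewrite -compA fwdK comp_idr. Qed.

Lemma bwdKr X Y Z (i : iso X Y) (f : mor Y Z) : f ∘ fwd i ∘ bwd i = f.
Proof. by rewrite -compA bwdK comp_idr. Qed.

Lemma iso_square X Y X' Y' (i : iso X X') (j : iso Y Y') (f : mor X Y)
    (g : mor X' Y') :
  fwd j ∘ f = g ∘ fwd i -> bwd j ∘ g = f ∘ bwd i.
Proof.
move=> e; apply: (@iso_epi _ _ i); apply: (@iso_mono _ _ j).
by rewrite fwdKr !compA bwdK comp_idl e.
Qed.

End Linear.

(** * Monoidal coherence *)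

Section Monoidal.
Variables (k : fieldType) (C : monoidalCategory k).
Implicit Types U V W X Y Z : C.

Lemma whl_comp W X Y Z (g : mor Y Z) (f : mor X Y) :
  W ◁ (g ∘ f) = (W ◁ g) ∘ (W ◁ f).
Proof. by rewrite -tensm_comp comp_idl. Qed.

Lemma whr_comp W X Y Z (g : mor Y Z) (f : mor X Y) :
  (g ∘ f) ▷ W = (g ▷ W) ∘ (f ▷ W).
Proof. by rewrite -tensm_comp comp_idl. Qed.

Lemma whlr X X' Y Y' (f : mor X X') (g : mor Y Y') :
  (X' ◁ g) ∘ (f ▷ Y) = f ⊗m g.
Proof. by rewrite -tensm_comp comp_idl comp_idr. Qed.

Lemma whrl X X' Y Y' (f : mor X X') (g : mor Y Y') :
  (f ▷ Y') ∘ (X ◁ g) = f ⊗m g.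
Proof. by rewrite -tensm_comp comp_idl comp_idr. Qed.

Lemma exch X X' Y Y' (f : mor X X') (g : mor Y Y') :
  (f ▷ Y') ∘ (X ◁ g) = (X' ◁ g) ∘ (f ▷ Y).
Proof. by rewrite whlr whrl. Qed.

Lemma assoc_nat1 X X' Y Z (f : mor X X') :
  α X' Y Z ∘ (f ▷ Y ▷ Z) = (f ▷ (Y ⊗ Z)) ∘ α X Y Z.
Proof. by rewrite assoc_nat tensm_id. Qed.

Lemma assoc_nat2 X Y Y' Z (f : mor Y Y') :
  α X Y' Z ∘ ((X ◁ f) ▷ Z) = (X ◁ (f ▷ Z)) ∘ α X Y Z.
Proof. by rewrite assoc_nat. Qed.

Lemma assoc_nat3 X Y Z Z' (f : mor Z Z') :
  α X Y Z' ∘ ((X ⊗ Y) ◁ f) = (X ◁ Y ◁ f) ∘ α X Y Z.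
Proof. by rewrite -assoc_nat tensm_id. Qed.

Lemma assoc_nat1' X X' Y Z (f : mor X X') :
  α' X' Y Z ∘ (f ▷ (Y ⊗ Z)) = (f ▷ Y ▷ Z) ∘ α' X Y Z.
Proof. exact/iso_square/assoc_nat1. Qed.

Lemma assoc_nat2' X Y Y' Z (f : mor Y Y') :
  α' X Y' Z ∘ (X ◁ (f ▷ Z)) = ((X ◁ f) ▷ Z) ∘ α' X Y Z.
Proof. exact/iso_square/assoc_nat2. Qed.

Lemma assoc_nat3' X Y Z Z' (f : mor Z Z') :
  α' X Y Z' ∘ (X ◁ Y ◁ f) = ((X ⊗ Y) ◁ f) ∘ α' X Y Z.
Proof. exact/iso_square/assoc_nat3. Qed.

Lemma lunit_nat' X X' (f : mor X X') : lu' X' ∘ f = (𝟙 ◁ f) ∘ lu' X.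
Proof. exact/iso_square/lunit_nat. Qed.

Lemma runit_nat' X X' (f : mor X X') : ru' X' ∘ f = (f ▷ 𝟙) ∘ ru' X.
Proof. exact/iso_square/runit_nat. Qed.

Lemma whl_unit_inj X Y (f g : mor X Y) : 𝟙 ◁ f = 𝟙 ◁ g -> f = g.
Proof.
by move=> e; apply: (@iso_epi _ _ _ _ (lunit X)); rewrite -!lunit_nat e.
Qed.

Lemma whr_unit_inj X Y (f g : mor X Y) : f ▷ 𝟙 = g ▷ 𝟙 -> f = g.
Proof.
by move=> e; apply: (@iso_epi _ _ _ _ (runit X)); rewrite -!runit_nat e.
Qed.

Definition whl_iso W X Y (i : iso X Y) : iso (W ⊗ X) (W ⊗ Y).
Proof.
exists (W ◁ fwd i) (W ◁ bwd i); first by rewrite -whl_comp fwdK tensm_id.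
by rewrite -whl_comp bwdK tensm_id.
Defined.

Definition whr_iso W X Y (i : iso X Y) : iso (X ⊗ W) (Y ⊗ W).
Proof.
exists (fwd i ▷ W) (bwd i ▷ W); first by rewrite -whr_comp fwdK tensm_id.
by rewrite -whr_comp bwdK tensm_id.
Defined.

Lemma triangle' X Y : ru X ▷ Y ∘ α' X 𝟙 Y = X ◁ lu Y.
Proof. by rewrite -triangle bwdKr. Qed.

Lemma triangle_inv X Y : α X 𝟙 Y ∘ (ru' X ▷ Y) = X ◁ lu' Y.
Proof.
apply: (@iso_mono _ _ _ _ (whl_iso X (lunit Y))) => /=.
by rewrite compA triangle -whr_comp -whl_comp !bwdK !tensm_id.
Qed.

(** Kelly's argument: tensoring with [𝟙] on the left is faithful, and after it the claim follows
    from the pentagon for [𝟙], [𝟙], [X], [Y] and two triangles. *)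
Lemma lunit_tens X Y : lu (X ⊗ Y) ∘ α 𝟙 X Y = lu X ▷ Y.
Proof.
apply: whl_unit_inj; apply: (iso_epi (i := assoc 𝟙 (𝟙 ⊗ X) Y)).
apply: (iso_epi (i := whr_iso Y (assoc 𝟙 𝟙 X))) => /=.
rewrite whl_comp (comp3 (esym (pentagon _ _ _ _))) !compA triangle.
by rewrite -assoc_nat1 -triangle whr_comp compA assoc_nat2 .
Qed.

Lemma lunit_tens_inv X Y : α 𝟙 X Y ∘ (lu' X ▷ Y) = lu' (X ⊗ Y).
Proof.
apply: (iso_mono (i := lunit (X ⊗ Y))).
by rewrite compA lunit_tens -whr_comp !bwdK tensm_id.
Qed.

Lemma lunit_tens_inv' X Y : α' 𝟙 X Y ∘ lu' (X ⊗ Y) = lu' X ▷ Y.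
Proof. by rewrite -lunit_tens_inv compA fwdK comp_idl. Qed.

Lemma runit_tens X Y : (X ◁ ru Y) ∘ α X Y 𝟙 = ru (X ⊗ Y).
Proof.
apply: whr_unit_inj; apply: (iso_mono (i := assoc X Y 𝟙)).
rewrite whr_comp compA assoc_nat2 -triangle whl_comp.
rewrite -triangle !compA assoc_nat3 -[RHS]compA pentagon.
by rewrite !compA.
Qed.

(** This and the next four lemmas solve the pentagon for the pairs of associators that meet in the
    computations below. *)
Lemma pentagon_l W X Y Z :
  (α W X Y ▷ Z) ∘ α' (W ⊗ X) Y Z
  = α' W (X ⊗ Y) Z ∘ (W ◁ α' X Y Z) ∘ α W X (Y ⊗ Z).
Proof.
apply: (iso_epi (i := assoc (W ⊗ X) Y Z)); rewrite fwdKr -compA pentagon !compA.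
rewrite (comp2 (esym (whl_comp _ _ _))) fwdK tensm_id comp_idr fwdK.
by rewrite comp_idl.
Qed.

Lemma pentagon_ll W X Y Z :
  (α W X Y ▷ Z) ∘ α' (W ⊗ X) Y Z ∘ α' W X (Y ⊗ Z)
  = α' W (X ⊗ Y) Z ∘ (W ◁ α' X Y Z).
Proof. by rewrite pentagon_l bwdKr. Qed.

Lemma pentagon_s W X Y Z :
  α W (X ⊗ Y) Z ∘ (α W X Y ▷ Z)
  = (W ◁ α' X Y Z) ∘ α W X (Y ⊗ Z) ∘ α (W ⊗ X) Y Z.
Proof.
by rewrite -compA pentagon !compA -whl_comp fwdK tensm_id comp_idl.
Qed.

Lemma pentagon_r W X Y Z :
  (α' W X Y ▷ Z) ∘ α' W (X ⊗ Y) Z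
  = α' (W ⊗ X) Y Z ∘ α' W X (Y ⊗ Z) ∘ (W ◁ α X Y Z).
Proof.
apply: (iso_mono (i := whr_iso Z (assoc W X Y))) => /=.
rewrite !compA pentagon_ll -whr_comp bwdK tensm_id comp_idl.
by rewrite -compA -whl_comp fwdK tensm_id comp_idr.
Qed.

Lemma pentagon_m W X Y Z :
  α (W ⊗ X) Y Z ∘ (α' W X Y ▷ Z)
  = α' W X (Y ⊗ Z) ∘ (W ◁ α X Y Z) ∘ α W (X ⊗ Y) Z.
Proof.
apply: (iso_mono (i := assoc W X (Y ⊗ Z))).
rewrite !compA bwdK comp_idl pentagon -compA -whr_comp bwdK tensm_id.
by rewrite comp_idr.
Qed.

End Monoidal.

Local Notation "X ^∨" := (ldual X) (at level 2, format "X ^∨") : cat_scope.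

(** * Duals *)

Section Rigid.
Variables (k : fieldType) (C : rigidCategory k).
Implicit Types A B U V W X Y Z : C.

(* The morphisms [capA], [evA] and [coevA] let a pairing or a copairing act to
   the left of an arbitrary object A, so that all objects stay bracketed to the
   right and the associators disappear from the computations. *)
Definition capA W V (p : mor (W ⊗ V) 𝟙) A : mor (W ⊗ (V ⊗ A)) A :=
  locked (lu A ∘ (p ▷ A) ∘ α' W V A).

Definition evA X A : mor (X^∨ ⊗ (X ⊗ A)) A := capA (ev X) A.

Definition coevA X A : mor A (X ⊗ (X^∨ ⊗ A)) :=
  locked (α X X^∨ A ∘ (coev X ▷ A) ∘ lu' A).

Lemma capAE W V (p : mor (W ⊗ V) 𝟙) A :
  capA p A = lu A ∘ (p ▷ A) ∘ α' W V A.
Proof. by rewrite /capA -lock. Qed.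

Lemma coevAE X A : coevA X A = α X X^∨ A ∘ (coev X ▷ A) ∘ lu' A.
Proof. by rewrite /coevA -lock. Qed.

Lemma capA_nat W V (p : mor (W ⊗ V) 𝟙) A B (g : mor A B) :
  capA p B ∘ (W ◁ V ◁ g) = g ∘ capA p A.
Proof.
rewrite !capAE (comp2 (assoc_nat3' _ _ _)) !compA (comp2 (exch _ _)) !compA.
by rewrite lunit_nat.
Qed.

Lemma capA_whl W W' V (p : mor (W ⊗ V) 𝟙) (f : mor W' W) A :
  capA p A ∘ (f ▷ (V ⊗ A)) = capA (p ∘ (f ▷ V)) A.
Proof. by rewrite !capAE (comp2 (assoc_nat1' _ _ _)) whr_comp !compA. Qed.

Lemma capA_whm W V V' (p : mor (W ⊗ V) 𝟙) (f : mor V' V) A :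
  capA p A ∘ (W ◁ (f ▷ A)) = capA (p ∘ (W ◁ f)) A.
Proof. by rewrite !capAE (comp2 (assoc_nat2' _ _ _)) whr_comp !compA. Qed.

Lemma capA_inj W V (p q : mor (W ⊗ V) 𝟙) : capA p 𝟙 = capA q 𝟙 -> p = q.
Proof.
rewrite !capAE => e; apply: whr_unit_inj.
exact/(iso_mono (i := lunit 𝟙))/(iso_epi' (i := assoc W V 𝟙))/e.
Qed.

Lemma capA_whr W V (p : mor (W ⊗ V) 𝟙) A B :
  capA p B ▷ A = capA p (B ⊗ A) ∘ (W ◁ α V B A) ∘ α W (V ⊗ B) A.
Proof.
rewrite !capAE !whr_comp -lunit_tens (comp2 (assoc_nat1 _ _ _)) !compA.
by rewrite (comp2 (pentagon_m _ _ _ _)) !compA.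
Qed.

Lemma evA_nat X A B (g : mor A B) :
  evA X B ∘ (X^∨ ◁ X ◁ g) = g ∘ evA X A.
Proof. exact: capA_nat. Qed.

Lemma coevA_nat X A B (g : mor A B) :
  (X ◁ X^∨ ◁ g) ∘ coevA X A = coevA X B ∘ g.
Proof.
rewrite !coevAE !compA -assoc_nat3 (comp2 (esym (exch _ _))) !compA.
by rewrite (comp2 (esym (lunit_nat' _))) !compA.
Qed.

Lemma zigzagA X A : (X ◁ evA X A) ∘ coevA X (X ⊗ A) = \id_(X ⊗ A).
Proof.
rewrite -tensm_id -[in RHS]zigzag !whr_comp -lunit_tens_inv' !compA.
rewrite (comp2 (esym (assoc_nat1' _ _ _))) !compA.
rewrite (comp2 (pentagon_l _ _ _ _)) !compA.
rewrite (comp2 (esym (assoc_nat2' _ _ _))) !compA triangle'.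
by rewrite -!whl_comp coevAE /evA capAE ?compA.
Qed.

Lemma zigzagA_dual X A : evA X (X^∨ ⊗ A) ∘ (X^∨ ◁ coevA X A) = \id_(X^∨ ⊗ A).
Proof.
rewrite -tensm_id -[in RHS]zigzag_dual !whr_comp coevAE !whl_comp -triangle_inv
  !compA.
rewrite (comp2 (esym (assoc_nat2 _ _ _))) !compA.
rewrite /evA capAE (comp3 (esym (pentagon_m _ _ _ _))) !compA.
by rewrite (comp2 (esym (assoc_nat1 _ _ _))) !compA lunit_tens.
Qed.

Lemma mate_whr W V (p : mor (W ⊗ V) 𝟙) A :
  mate p ▷ A = capA p (V^∨ ⊗ A) ∘ (W ◁ coevA V A).
Proof.
have -> : mate p = capA p V^∨ ∘ (W ◁ coev V) ∘ ru' W.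
  by rewrite capAE.
rewrite 2!whr_comp capA_whr coevAE 2!whl_comp.
rewrite (comp2 (assoc_nat2 _ _ _)) !compA.
by rewrite (comp2 (triangle_inv _ _)).
Qed.

Lemma evA_mate W V (p : mor (W ⊗ V) 𝟙) A :
  evA V A ∘ (mate p ▷ (V ⊗ A)) = capA p A.
Proof.
rewrite mate_whr compA -capA_nat -compA -whl_comp zigzagA tensm_id.
by rewrite comp_idr.
Qed.

Lemma ev_mate W V (p : mor (W ⊗ V) 𝟙) : ev V ∘ (mate p ▷ V) = p.
Proof. by apply: capA_inj; rewrite -capA_whl -/(evA V 𝟙) evA_mate. Qed.

(** A zigzag recovers [f] from the pairing it defines; with [ev_inj_r], equations between morphisms
    reduce to equations between pairings. *)
Lemma ev_inj_l W V (f g : mor W V^∨) :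
  ev V ∘ (f ▷ V) = ev V ∘ (g ▷ V) -> f = g.
Proof.
move=> e; apply: whr_unit_inj; rewrite -[LHS]comp_idl -[RHS]comp_idl.
rewrite -zigzagA_dual -!compA -!exch !compA !capA_whl.
by rewrite e.
Qed.

Lemma ev_inj_r U V (f g : mor U V) :
  ev V ∘ (V^∨ ◁ f) = ev V ∘ (V^∨ ◁ g) -> f = g.
Proof.
move=> e; apply: whr_unit_inj; rewrite -[LHS]comp_idl -[RHS]comp_idl.
rewrite -(zigzagA V 𝟙) -!compA -!coevA_nat !compA -!whl_comp !capA_whm.
by rewrite e.
Qed.

Lemma ev_dualm X Y (f : mor X Y) :
  ev X ∘ (dualm f ▷ X) = ev Y ∘ (Y^∨ ◁ f).
Proof. exact: ev_mate. Qed.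

Lemma evA_dualm X Y (f : mor X Y) A :
  evA X A ∘ (dualm f ▷ (X ⊗ A)) = evA Y A ∘ (Y^∨ ◁ (f ▷ A)).
Proof. by rewrite /evA capA_whl ev_dualm capA_whm. Qed.

Lemma dualm_comp X Y Z (g : mor Y Z) (f : mor X Y) :
  dualm (g ∘ f) = dualm f ∘ dualm g.
Proof.
apply: ev_inj_l; rewrite ev_dualm whr_comp compA ev_dualm -compA -exch compA.
by rewrite ev_dualm -compA -whl_comp.
Qed.

Lemma coevA_dualm X Y (f : mor X Y) A :
  (Y ◁ (dualm f ▷ A)) ∘ coevA Y A = (f ▷ (X^∨ ⊗ A)) ∘ coevA X A.
Proof.
rewrite /dualm mate_whr -capA_whm -/(evA Y _) !whl_comp -!compA.
rewrite coevA_nat !compA -!whl_comp; congr (_ ∘ _).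
by rewrite whl_comp -compA coevA_nat compA zigzagA comp_idl.
Qed.

Lemma tensm0l X X' Y Y' (g : mor Y Y') : (0 : mor X X') ⊗m g = 0.
Proof.
have := tensm_linear_l g (-1) (0 : mor X X') 0.
by rewrite scaleN1r oppr0 add0r scaleN1r addNr.
Qed.

Lemma tensm0r X X' Y Y' (f : mor X X') : f ⊗m (0 : mor Y Y') = 0.
Proof.
have := tensm_linear_r f (-1) (0 : mor Y Y') 0.
by rewrite scaleN1r oppr0 add0r scaleN1r addNr.
Qed.

Lemma tensmZl X X' Y Y' c (f : mor X X') (g : mor Y Y') :
  (c *: f) ⊗m g = c *: (f ⊗m g).
Proof. by have := tensm_linear_l g c f 0; rewrite tensm0l !addr0. Qed.

Lemma tensmZr X X' Y Y' c (f : mor X X') (g : mor Y Y') :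
  f ⊗m (c *: g) = c *: (f ⊗m g).
Proof. by have := tensm_linear_r f c g 0; rewrite tensm0r !addr0. Qed.

Lemma tensmDl X X' Y Y' (f h : mor X X') (g : mor Y Y') :
  (f + h) ⊗m g = (f ⊗m g) + (h ⊗m g).
Proof. by have := tensm_linear_l g 1 f h; rewrite !scale1r. Qed.

Lemma tensmDr X X' Y Y' (f : mor X X') (g h : mor Y Y') :
  f ⊗m (g + h) = (f ⊗m g) + (f ⊗m h).
Proof. by have := tensm_linear_r f 1 g h; rewrite !scale1r. Qed.

Lemma tensm_suml X X' Y Y' (I : finType) (f : I -> mor X X') (g : mor Y Y') :
  (\sum_i f i) ⊗m g = \sum_i (f i ⊗m g).
Proof.
by apply: (big_morph (fun f => f ⊗m g)) => [u v|]; rewrite ?tensmDl ?tensm0l.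
Qed.

Lemma tensm_sumr X X' Y Y' (I : finType) (f : mor X X') (g : I -> mor Y Y') :
  f ⊗m (\sum_i g i) = \sum_i (f ⊗m g i).
Proof.
by apply: (big_morph (fun g => f ⊗m g)) => [u v|]; rewrite ?tensmDr ?tensm0r.
Qed.

Lemma dualmZ X Y c (f : mor X Y) : dualm (c *: f) = c *: dualm f.
Proof.
by apply: ev_inj_l; rewrite ev_dualm tensmZr tensmZl !compZr ev_dualm.
Qed.

Lemma dualmD X Y (f g : mor X Y) : dualm (f + g) = dualm f + dualm g.
Proof.
by apply: ev_inj_l; rewrite ev_dualm tensmDr tensmDl !compDr !ev_dualm.
Qed.

Lemma dualm0 X Y : dualm (0 : mor X Y) = 0.
Proof. by rewrite -(scale0r 0) dualmZ scale0r. Qed.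

Lemma dualm_sum X Y (I : finType) (f : I -> mor X Y) :
  dualm (\sum_i f i) = \sum_i dualm (f i).
Proof.
by apply: (big_morph (fun f => dualm f)) => [u v|]; rewrite ?dualmD ?dualm0.
Qed.

Lemma dualm_eq0 X Y (f : mor X Y) : dualm f = 0 -> f = 0.
Proof.
move=> f0; apply: ev_inj_r; rewrite -ev_dualm f0.
by rewrite tensm0l tensm0r !comp0r.
Qed.

(** The adjunction between [- ⊗ A] and [- ⊗ A^∨], which carries epimorphisms and the universal
    property of the coend through a tensor factor. *)
Definition curry B A V (h : mor (B ⊗ A) V) : mor B (V ⊗ A^∨) :=
  locked ((h ▷ A^∨) ∘ α' B A A^∨ ∘ (B ◁ coev A) ∘ ru' B).

Definition uncurry B A V (h : mor B (V ⊗ A^∨)) : mor (B ⊗ A) V :=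
  locked (ru V ∘ (V ◁ ev A) ∘ α V A^∨ A ∘ (h ▷ A)).

Lemma curryK B A V (h : mor (B ⊗ A) V) : uncurry (curry h) = h.
Proof.
rewrite /uncurry /curry -!lock !whr_comp !compA (comp2 (assoc_nat1 _ _ _))
  !compA.
rewrite (comp2 (esym (exch _ _))) !compA runit_nat.
rewrite (comp2 (pentagon_m _ _ _ _)) !compA.
rewrite (comp2 (esym (assoc_nat3' _ _ _))) !compA.
rewrite -(comp2 (runit_tens _ _)) bwdKr.
rewrite (comp2 (assoc_nat2 _ _ _)) !compA (comp2 (triangle_inv _ _)).
by rewrite -!compA -!whl_comp !compA zigzag tensm_id comp_idr.
Qed.

Lemma curry_whr B B' A V (h : mor (B ⊗ A) V) (f : mor B' B) :
  curry (h ∘ (f ▷ A)) = curry h ∘ f.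
Proof.
rewrite /curry -!lock (comp2 (runit_nat' _)) !compA (comp2 (esym (exch _ _)))
  !compA.
by rewrite (comp2 (assoc_nat1' _ _ _)) !compA -whr_comp.
Qed.

Lemma comp_uncurry B A V V' (g : mor V V') (h : mor B (V ⊗ A^∨)) :
  g ∘ uncurry h = uncurry ((g ▷ A^∨) ∘ h).
Proof.
rewrite /uncurry -!lock whr_comp !compA -runit_nat (comp2 (assoc_nat1 _ _ _))
  !compA.
by rewrite (comp2 (exch _ _)) !compA.
Qed.

Lemma uncurry_whr B B' A V (h : mor B (V ⊗ A^∨)) (f : mor B' B) :
  uncurry h ∘ (f ▷ A) = uncurry (h ∘ f).
Proof. by rewrite /uncurry -!lock whr_comp !compA. Qed.

Lemma curry_inj B A V (g h : mor (B ⊗ A) V) : curry g = curry h -> g = h.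
Proof. by move=> e; rewrite -[g]curryK e curryK. Qed.

Lemma epic_whr X Y A (f : mor X Y) : epic f -> epic (f ▷ A).
Proof.
move=> ef Z g h e; apply/curry_inj/ef.
by rewrite -!curry_whr e.
Qed.

(** [X ⊗ -] is a right adjoint of [X^∨ ⊗ -]; [flat] rebuilds a morphism from its adjunct. *)
Lemma monic_whl X A B (f : mor A B) : monic f -> monic (X ◁ f).
Proof.
move=> mf W g h e.
have flat (u : mor W (X ⊗ A)) : u = (X ◁ (evA X A ∘ (X^∨ ◁ u))) ∘ coevA X W.
  by rewrite whl_comp -compA coevA_nat compA zigzagA comp_idl.
rewrite [g]flat [h]flat; congr (X ◁ _ ∘ _); apply: mf.
by rewrite !compA -!evA_nat -!compA -!whl_comp e.
Qed.

End Rigid.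

(** * Morphisms acting next to a spectator object *)

Section ActA.
Variables (k : fieldType) (C : monoidalCategory k).
Implicit Types A B T U V W X Y Z : C.

(** With [fuseA] and [pointA], the convention of [capA] for morphisms from two objects to two, from
    two to one, and from the unit to one. *)
Definition actA X Y Z W (d : mor (X ⊗ Y) (Z ⊗ W)) A :
    mor (X ⊗ (Y ⊗ A)) (Z ⊗ (W ⊗ A)) :=
  locked (α Z W A ∘ (d ▷ A) ∘ α' X Y A).

Lemma actAE X Y Z W (d : mor (X ⊗ Y) (Z ⊗ W)) A :
  actA d A = α Z W A ∘ (d ▷ A) ∘ α' X Y A.
Proof. by rewrite /actA -lock. Qed.

Lemma actA_nat X Y Z W (d : mor (X ⊗ Y) (Z ⊗ W)) A B (g : mor A B) :
  actA d B ∘ (X ◁ Y ◁ g) = (Z ◁ W ◁ g) ∘ actA d A.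
Proof.
rewrite !actAE (comp2 (assoc_nat3' _ _ _)) !compA (comp2 (exch _ _)) !compA.
by rewrite assoc_nat3.
Qed.

Lemma actA_comp U V X Y Z W (d : mor (X ⊗ Y) (Z ⊗ W))
    (e : mor (U ⊗ V) (X ⊗ Y)) A :
  actA (d ∘ e) A = actA d A ∘ actA e A.
Proof. by rewrite !actAE whr_comp !compA fwdKr. Qed.

Lemma actA_id X Y A : actA \id_(X ⊗ Y) A = \id_(X ⊗ (Y ⊗ A)).
Proof. by rewrite actAE tensm_id comp_idr bwdK. Qed.

Lemma actA_tens X Y Z W (f : mor X Z) (g : mor Y W) A :
  actA (f ⊗m g) A = f ⊗m (g ▷ A).
Proof. by rewrite actAE assoc_nat bwdKr. Qed.

Lemma assoc_actA X Y Z W (d : mor (X ⊗ Y) (Z ⊗ W)) A :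
  α' Z W A ∘ actA d A = (d ▷ A) ∘ α' X Y A.
Proof. by rewrite actAE !compA fwdK comp_idl. Qed.

Definition fuseA X Y Z (f : mor (X ⊗ Y) Z) A : mor (X ⊗ (Y ⊗ A)) (Z ⊗ A) :=
  locked ((f ▷ A) ∘ α' X Y A).

Lemma fuseAE X Y Z (f : mor (X ⊗ Y) Z) A : fuseA f A = (f ▷ A) ∘ α' X Y A.
Proof. by rewrite /fuseA -lock. Qed.

Lemma fuseA_nat X Y Z (f : mor (X ⊗ Y) Z) A B (g : mor A B) :
  fuseA f B ∘ (X ◁ Y ◁ g) = (Z ◁ g) ∘ fuseA f A.
Proof. by rewrite !fuseAE (comp2 (assoc_nat3' _ _ _)) !compA exch. Qed.

Lemma fuseA_whm X Y Y' Z (f : mor (X ⊗ Y) Z) (g : mor Y' Y) A :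
  fuseA f A ∘ (X ◁ (g ▷ A)) = fuseA (f ∘ (X ◁ g)) A.
Proof. by rewrite !fuseAE (comp2 (assoc_nat2' _ _ _)) whr_comp !compA. Qed.

Lemma whr_fuseA X Y Z W (f : mor (X ⊗ Y) Z) (g : mor Z W) A :
  (g ▷ A) ∘ fuseA f A = fuseA (g ∘ f) A.
Proof. by rewrite !fuseAE whr_comp !compA. Qed.

Definition pointA U (l : mor 𝟙 U) A : mor A (U ⊗ A) := locked ((l ▷ A) ∘ lu' A).

Lemma pointAE U (l : mor 𝟙 U) A : pointA l A = (l ▷ A) ∘ lu' A.
Proof. by rewrite /pointA -lock. Qed.

Lemma pointA_nat U (l : mor 𝟙 U) A B (g : mor A B) :
  (U ◁ g) ∘ pointA l A = pointA l B ∘ g.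
Proof.
by rewrite !pointAE (comp2 (lunit_nat' _)) !compA exch.
Qed.

Lemma whr_pointA U V (l : mor 𝟙 U) (f : mor U V) A :
  (f ▷ A) ∘ pointA l A = pointA (f ∘ l) A.
Proof. by rewrite !pointAE whr_comp !compA. Qed.

Lemma fuseA_pointA U Z W (f : mor (U ⊗ Z) W) (l : mor 𝟙 U) A :
  fuseA f A ∘ pointA l (Z ⊗ A) = (f ∘ pointA l Z) ▷ A.
Proof.
rewrite fuseAE !pointAE -(lunit_tens_inv Z A) !compA.
by rewrite (comp2 (assoc_nat1' _ _ _)) !compA fwdKr !whr_comp.
Qed.

Definition actA_iso X Y Z W (i : iso (X ⊗ Y) (Z ⊗ W)) A :
  iso (X ⊗ (Y ⊗ A)) (Z ⊗ (W ⊗ A)).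
Proof.
exists (actA (fwd i) A) (actA (bwd i) A).
  by rewrite -actA_comp fwdK actA_id.
by rewrite -actA_comp bwdK actA_id.
Defined.

End ActA.

(** * Braidings *)

Section Braiding.
Variables (k : fieldType) (C : ribbonCategory k).
Implicit Types A B U V W X Y Z : C.

Local Notation c X Y := (fwd (braid X Y)).
Local Notation c' X Y := (bwd (braid X Y)).

Lemma braidA_natl X X' Y A (f : mor X X') :
  actA (c X' Y) A ∘ (f ▷ (Y ⊗ A)) = (Y ◁ (f ▷ A)) ∘ actA (c X Y) A.
Proof. by rewrite -tensm_id -!actA_tens -!actA_comp braid_nat. Qed.

Lemma braidA_natr X Y Y' A (f : mor Y Y') :
  actA (c X Y') A ∘ (X ◁ (f ▷ A)) = (f ▷ (X ⊗ A)) ∘ actA (c X Y) A.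
Proof.
by rewrite -[f ▷ (X ⊗ A)]/(f ⊗m _) -tensm_id -!actA_tens -!actA_comp braid_nat.
Qed.

Lemma braidA_tensr X Y Z A :
  α Y Z (X ⊗ A) ∘ actA (c X (Y ⊗ Z)) A
  = (Y ◁ actA (c X Z) A) ∘ actA (c X Y) (Z ⊗ A) ∘ (X ◁ α Y Z A).
Proof.
have -> : c X (Y ⊗ Z) = α' Y Z X ∘ (Y ◁ c X Z) ∘ α Y X Z ∘ (c X Y ▷ Z) ∘ α' X Y
  Z.
  by rewrite (comp3 (esym (hexagon_r _ _ _))) !compA fwdK comp_idl bwdKr.
rewrite !actAE 4!whr_comp !compA -[_ ∘ α (Y ⊗ Z) X A ∘ _]compA pentagon_m.
rewrite !compA bwdK comp_idl.
rewrite (comp2 (assoc_nat2 _ _ _)) !compA.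
rewrite (comp2 (pentagon_s _ _ _ _)) !compA -!whl_comp.
rewrite (comp2 (assoc_nat1 _ _ _)) !compA.
by rewrite (comp2 (pentagon_r _ _ _ _)) !compA bwdKr.
Qed.

Lemma braidA_tensl X Y Z A :
  (Z ◁ α X Y A) ∘ actA (c (X ⊗ Y) Z) A
  = actA (c X Z) (Y ⊗ A) ∘ (X ◁ actA (c Y Z) A) ∘ α X Y (Z ⊗ A).
Proof.
have -> : c (X ⊗ Y) Z = α Z X Y ∘ (c X Z ▷ Y) ∘ α' X Z Y ∘ (X ◁ c Y Z) ∘ α X Y
  Z.
  by rewrite (comp3 (esym (hexagon_l _ _ _))) !compA bwdK comp_idl fwdKr.
rewrite !actAE 4!whr_comp !compA (comp2 (pentagon_s _ _ _ _)) !compA.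
rewrite -whl_comp bwdK tensm_id comp_idl (comp2 (assoc_nat1 _ _ _)) !compA.
rewrite (comp2 (pentagon_m _ _ _ _)) !compA (comp2 (assoc_nat2 _ _ _)) !compA.
rewrite (comp2 (pentagon_s _ _ _ _)) !compA bwdKr.
by rewrite !whl_comp !compA.
Qed.

(** The hexagon for [𝟙 ⊗ 𝟙] makes the braiding with [𝟙] idempotent up to unit isomorphisms, and it
    is invertible, hence trivial. The hexagon yields this for the spectator [𝟙 ⊗ A], which [lunit]
    then replaces by [A]. *)
Lemma braidA_unitl X A : (X ◁ lu A) ∘ actA (c 𝟙 X) A = lu (X ⊗ A).
Proof.
have e : (X ◁ lu (𝟙 ⊗ A)) ∘ actA (c 𝟙 X) (𝟙 ⊗ A) = lu (X ⊗ (𝟙 ⊗ A)).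
  apply: (iso_epi (i := whl_iso 𝟙 (actA_iso (braid 𝟙 X) A))).
  apply: (iso_epi (i := assoc 𝟙 𝟙 (X ⊗ A))) => /=.
  rewrite lunit_nat (comp3 (esym (braidA_tensl _ _ _ _))) !compA.
  rewrite -whl_comp !lunit_tens (comp2 (lunit_tens _ _)).
  by rewrite braidA_natl.
apply: (iso_epi (i := whl_iso 𝟙 (whl_iso X (lunit A)))) => /=.
rewrite -compA actA_nat lunit_nat -e !compA -!whl_comp.
by rewrite lunit_nat.
Qed.

Lemma braidA_unitr X A : lu (X ⊗ A) ∘ actA (c X 𝟙) A = X ◁ lu A.
Proof.
have e : lu (X ⊗ (𝟙 ⊗ A)) ∘ actA (c X 𝟙) (𝟙 ⊗ A) = X ◁ lu (𝟙 ⊗ A).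
  apply: (iso_epi (i := whl_iso X (assoc 𝟙 𝟙 A))).
  apply: (iso_mono (i := actA_iso (braid X 𝟙) A)) => /=.
  rewrite -whl_comp lunit_tens braidA_natr !compA -lunit_nat.
  by rewrite (comp3 (esym (braidA_tensr _ _ _ _))) !compA lunit_tens.
apply: (iso_epi (i := whl_iso X (whl_iso 𝟙 (lunit A)))) => /=.
rewrite -compA actA_nat compA lunit_nat -compA e -!whl_comp.
by rewrite lunit_nat.
Qed.

(** Naturality of the braiding at [p]: a strand [Y] that crosses both legs of a cap can be pulled
    off it. *)
Lemma braidA_capr W V (p : mor (W ⊗ V) 𝟙) Y A :
  capA p (Y ⊗ A) ∘ (W ◁ actA (c Y V) A) ∘ actA (c Y W) (V ⊗ A)
  = Y ◁ capA p A.
Proof.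
rewrite !capAE 2!whl_comp -braidA_unitr (comp2 (braidA_natr _ _ _)) !compA.
apply: (iso_epi (i := whl_iso Y (assoc W V A))) => /=.
rewrite (comp3 (esym (braidA_tensr _ _ _ _))) !compA fwdKr.
by rewrite -[RHS]compA -whl_comp fwdK tensm_id comp_idr.
Qed.

Lemma braidA_capl W V (p : mor (W ⊗ V) 𝟙) Y A :
  (Y ◁ capA p A) ∘ actA (c W Y) (V ⊗ A) ∘ (W ◁ actA (c V Y) A)
  = capA p (Y ⊗ A).
Proof.
rewrite !capAE 2!whl_comp -braidA_unitl.
apply: (iso_epi (i := assoc W V (Y ⊗ A))) => /=.
rewrite (comp3 (esym (braidA_tensl _ _ _ _))) !compA fwdKr.
rewrite (comp2 (esym (whl_comp _ _ _))) fwdK tensm_id comp_idr.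
by rewrite (comp2 (braidA_natl _ _ _)) !compA.
Qed.

Lemma braidA_evr X Y A :
  evA X (Y ⊗ A) ∘ (X^∨ ◁ actA (c Y X) A) ∘ actA (c Y X^∨) (X ⊗ A)
  = Y ◁ evA X A.
Proof. exact: braidA_capr. Qed.

Lemma braidA_evl X Y A :
  (Y ◁ evA X A) ∘ actA (c X^∨ Y) (X ⊗ A) ∘ (X^∨ ◁ actA (c X Y) A)
  = evA X (Y ⊗ A).
Proof. exact: braidA_capl. Qed.

Lemma braidA_fuse X Y U (f : mor (X ⊗ Y) U) Z A :
  actA (c U Z) A ∘ fuseA f (Z ⊗ A)
  = (Z ◁ fuseA f A) ∘ actA (c X Z) (Y ⊗ A) ∘ (X ◁ actA (c Y Z) A).
Proof.
rewrite !fuseAE whl_comp; apply: (iso_epi (i := assoc X Y (Z ⊗ A))) => /=.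
rewrite (comp3 (esym (braidA_tensl _ _ _ _))) !compA fwdKr braidA_natl.
by rewrite (comp2 (esym (whl_comp _ _ _))) fwdK tensm_id comp_idr.
Qed.

Lemma braidA_point U (l : mor 𝟙 U) Y A :
  actA (c U Y) A ∘ pointA l (Y ⊗ A) = Y ◁ pointA l A.
Proof.
rewrite !pointAE compA braidA_natl whl_comp; apply: (iso_epi (i := lunit _)).
rewrite fwdKr -[lu (Y ⊗ A)]braidA_unitl !compA.
by rewrite (comp2 (esym (whl_comp _ _ _))) fwdK tensm_id comp_idr.
Qed.

End Braiding.

(** * The coend and its integral *)

Section Coend.
Variables (k : fieldType) (C : ribbonCategory k) (L : coend C).
Implicit Types A B U V W X Y Z : C.

Local Notation c X Y := (fwd (braid X Y)).
Local Notation jA X A := (fuseA (cj L X) A).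

Lemma cj_epi V (f g : mor L V) : (forall X, f ∘ cj L X = g ∘ cj L X) -> f = g.
Proof.
move=> e.
have [|h [_ hu]] := @cj_universal _ _ L V (fun X => g ∘ cj L X).
  by move=> X Y u; rewrite -!compA cj_dinatural.
by rewrite -(hu f e) -(hu g).
Qed.

(** [- ⊗ A] is a left adjoint and so preserves the coend; currying reduces this and [jA_universal]
    to [L] itself. *)
Lemma jA_epi A V (f g : mor (L ⊗ A) V) :
  (forall X, f ∘ jA X A = g ∘ jA X A) -> f = g.
Proof.
move=> e; apply/curry_inj/cj_epi => X; rewrite -!curry_whr.
by have := e X; rewrite fuseAE !compA => /(@iso_epi' _ _ _ _ (assoc _ _ _)) ->.
Qed.

Lemma jA_universal A V (g : forall X, mor (X^∨ ⊗ (X ⊗ A)) V) :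
  (forall X Y (f : mor X Y),
     g X ∘ (dualm f ▷ (X ⊗ A)) = g Y ∘ (Y^∨ ◁ (f ▷ A))) ->
  exists h : mor (L ⊗ A) V, forall X, h ∘ jA X A = g X.
Proof.
move=> gd.
have [|h [hE _]] := @cj_universal _ _ L _ (fun X => curry (g X ∘ α X^∨ X A)).
  move=> X Y f; rewrite -!curry_whr (comp2 (assoc_nat1 _ _ _)).
  by rewrite (comp2 (assoc_nat2 _ _ _)) !compA gd.
exists (uncurry h) => X.
by rewrite fuseAE compA uncurry_whr hE curryK bwdKr.
Qed.

(* A loop of colour X, with its strand X braided around the strand Z in the way
   prescribed by d; integrated over X it becomes an action of L on Z. *)
Definition encircle (d : forall X Z : C, mor (X ⊗ Z) (X ⊗ Z)) Z :
    mor (L ⊗ Z) Z :=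
  xget 0 [set r | forall X, r ∘ jA X Z = evA X Z ∘ (X^∨ ◁ d X Z)].

Section Encircle.
Variable d : forall X Z : C, mor (X ⊗ Z) (X ⊗ Z).
Hypothesis d_nat : forall X X' Z Z' (f : mor X X') (g : mor Z Z'),
  d X' Z' ∘ (f ⊗m g) = (f ⊗m g) ∘ d X Z.

Lemma encircleE X Z : encircle d Z ∘ jA X Z = evA X Z ∘ (X^∨ ◁ d X Z).
Proof.
(* The default value 0 is excluded: since [d] is natural the family is dinatural, and [jA_universal]
   gives a solution. *)
rewrite /encircle; case: xgetP => [_ _ ->//|no]; exfalso.
have [|r rE] := @jA_universal Z Z (fun X => evA X Z ∘ (X^∨ ◁ d X Z)); last
  first.
  exact: (no r).
move=> {X no} X Y f; rewrite -!compA -exch -whl_comp d_nat whl_comp !compA.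
by rewrite evA_dualm.
Qed.

Lemma encircleA X Z A :
  fuseA (encircle d Z) A ∘ jA X (Z ⊗ A)
  = evA X (Z ⊗ A) ∘ (X^∨ ◁ actA (d X Z) A).
Proof.
rewrite !fuseAE !compA (comp2 (assoc_nat1' _ _ _)) !compA -whr_comp.
have -> : encircle d Z ∘ (cj L X ▷ Z)
          = evA X Z ∘ (X^∨ ◁ d X Z) ∘ α X^∨ X Z.
  by rewrite -encircleE fuseAE compA fwdKr.
rewrite 2!whr_comp (comp2 (pentagon_l _ _ _ _)) !compA bwdKr.
rewrite /evA capA_whr actAE 2!whl_comp !compA (comp2 (assoc_nat2 _ _ _)) !compA.
by rewrite bwdKr.
Qed.

Lemma encircle_nat Z Z' (f : mor Z Z') :
  encircle d Z' ∘ (L ◁ f) = f ∘ encircle d Z.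
Proof.
apply: jA_epi => X; rewrite -!compA -fuseA_nat encircleE !compA encircleE.
by rewrite -!compA -!whl_comp d_nat whl_comp !compA evA_nat.
Qed.

Definition loop (l : mor 𝟙 L) Z : mor Z Z := encircle d Z ∘ pointA l Z.

Lemma loop_nat l Z Z' (f : mor Z Z') : loop l Z' ∘ f = f ∘ loop l Z.
Proof. by rewrite /loop -compA -pointA_nat !compA encircle_nat. Qed.

Lemma loopA l Z A :
  fuseA (encircle d Z) A ∘ pointA l (Z ⊗ A) = loop l Z ▷ A.
Proof. exact: fuseA_pointA. Qed.

End Encircle.

Lemma evA_dual_tens X Y A :
  evA (Y ⊗ X) A ∘ ((Y ⊗ X)^∨ ◁ α' Y X A)
    ∘ fuseA (dual_tens Y X) (Y ⊗ (X ⊗ A))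
  = evA X A ∘ (X^∨ ◁ evA Y (X ⊗ A)).
Proof.
rewrite fuseAE !compA (comp2 (esym (exch _ _))) !compA evA_mate.
rewrite -[_ ∘ _ ∘ α' Y^∨ Y X](capAE (ev Y)) capAE 2!whr_comp !compA.
rewrite (comp2 (pentagon_l _ _ _ _)) !compA (comp2 (assoc_nat3 _ _ _)) !compA.
rewrite bwdKr (comp2 (esym (assoc_nat2' _ _ _))) !compA /evA capA_whr.
rewrite capAE -!compA -!whl_comp !compA.
rewrite bwdKr (comp2 (esym (whl_comp _ _ _))) bwdK tensm_id comp_idr.
by rewrite capAE.
Qed.

Lemma braidA_tensl' X Y Z A :
  actA (c (X ⊗ Y) Z) A ∘ α' X Y (Z ⊗ A)
  = (Z ◁ α' X Y A) ∘ actA (c X Z) (Y ⊗ A) ∘ (X ◁ actA (c Y Z) A).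
Proof.
apply: (iso_epi (i := assoc X Y (Z ⊗ A))); rewrite fwdKr.
apply: (iso_mono (i := whl_iso Z (assoc X Y A))) => /=.
by rewrite braidA_tensl !compA -whl_comp bwdK tensm_id comp_idl.
Qed.

(** The product formula with the braiding of [Y^∨ ⊗ Y] past [X^∨] split by a hexagon into its two
    crossings. *)
Lemma cmul_jA X Y A :
  (cmul L ▷ A) ∘ α' L L A ∘ (L ◁ jA X A) ∘ jA Y (X^∨ ⊗ (X ⊗ A))
  = jA (Y ⊗ X) A ∘ ((Y ⊗ X)^∨ ◁ α' Y X A)
    ∘ fuseA (dual_tens Y X) (Y ⊗ (X ⊗ A))
    ∘ actA (c Y^∨ X^∨) (Y ⊗ (X ⊗ A)) ∘ (Y^∨ ◁ actA (c Y X^∨) (X ⊗ A)).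
Proof.
rewrite !fuseAE whl_comp !compA (comp2 (assoc_nat2' _ _ _)) !compA.
rewrite (comp2 (esym (exch _ _))) !compA (comp2 (assoc_nat1' _ _ _)) !compA.
rewrite -!whr_comp (comp2 (whlr _ _)) cmulE /coend_shuffle !compA 5!whr_comp.
rewrite (comp2 (pentagon_r _ _ _ _)) !compA.
rewrite (comp2 (esym (whl_comp _ _ _))) bwdK tensm_id comp_idr.
rewrite (comp2 (esym (assoc_nat1' _ _ _))) !compA.
rewrite (comp2 (esym (assoc_nat1' _ _ _))) !compA.

rewrite (comp2 (esym (assoc_actA _ _))) !compA.
rewrite (comp2 (braidA_tensl' _ _ _ _)) !compA.
rewrite (comp2 (pentagon_r _ _ _ _)) !compA.
rewrite (comp2 (esym (whl_comp _ _ _))) bwdK tensm_id comp_idr.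
rewrite (comp3 (pentagon_ll _ _ _ _)) !compA.
rewrite (comp2 (esym (assoc_nat1' _ _ _))) !compA.
by rewrite (comp2 (exch _ _)) !compA.
Qed.

Section Integral.
Variable Lam : mor 𝟙 L.
Hypothesis Lam_integral : cmul L ∘ (Lam ▷ L) = Lam ∘ ccounit L ∘ lu L.

Lemma counitA_jA X A : lu A ∘ (ccounit L ▷ A) ∘ jA X A = evA X A.
Proof. by rewrite fuseAE /evA capAE !compA (comp2 (esym (whr_comp _ _ _)))
  ccounitE. Qed.

(* The defining property of the integral, tested against the functional F:
   since the braiding of L with the dual of X is undone at Lam, multiplying by
   the coefficients of X amounts to putting an X-coloured strand through the
   loop. *)
Lemma integral_slide A V X (F : mor (L ⊗ A) V)
    (G : mor (X^∨ ⊗ (L ⊗ (X ⊗ A))) V) :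
  (forall Y, G ∘ (X^∨ ◁ jA Y (X ⊗ A))
     = F ∘ jA (Y ⊗ X) A ∘ ((Y ⊗ X)^∨ ◁ α' Y X A)
         ∘ fuseA (dual_tens Y X) (Y ⊗ (X ⊗ A))) ->
  G ∘ (X^∨ ◁ pointA Lam (X ⊗ A)) = F ∘ pointA Lam A ∘ evA X A.
Proof.
move=> GF.
have e : F ∘ (cmul L ▷ A) ∘ α' L L A ∘ (L ◁ jA X A)
         = G ∘ actA (c L X^∨) (X ⊗ A).
  apply: jA_epi => Y; rewrite -!compA braidA_fuse !compA GF.
  have := congr1 (fun u => F ∘ u) (cmul_jA X Y A); rewrite !compA => ->.
  by [].
(* At the point [Lam] the braiding with [X^∨] is trivial, and the integral equation turns the
   product into the counit. *)
rewrite -braidA_point compA -e (comp2 (pointA_nat _ _)) !compA.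
rewrite -[F ∘ _ ∘ _]compA -fuseAE (comp2 (fuseA_pointA _ _ _)).
rewrite pointAE compA Lam_integral bwdKr whr_comp -counitA_jA pointAE !compA.
by rewrite fwdKr.
Qed.

End Integral.

End Coend.

(** * Double braidings *)

Section DoubleBraiding.
Variables (k : fieldType) (C : ribbonCategory k).
Implicit Types A B U V W X Y Z : C.

Local Notation c X Y := (fwd (braid X Y)).
Local Notation c' X Y := (bwd (braid X Y)).

Definition dbraid X Z : iso (X ⊗ Z) (X ⊗ Z).
Proof.
apply: locked; exists (c Z X ∘ c X Z) (c' X Z ∘ c' Z X).
  by rewrite !compA fwdKr fwdK.
by rewrite !compA bwdKr bwdK.
Defined.

Lemma dbraidE X Z : fwd (dbraid X Z) = c Z X ∘ c X Z.
Proof. by rewrite /dbraid -lock. Qed.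

Lemma dbraidE' X Z : bwd (dbraid X Z) = c' X Z ∘ c' Z X.
Proof. by rewrite /dbraid -lock. Qed.

Lemma dbraid_nat X X' Z Z' (f : mor X X') (g : mor Z Z') :
  fwd (dbraid X' Z') ∘ (f ⊗m g) = (f ⊗m g) ∘ fwd (dbraid X Z).
Proof. by rewrite !dbraidE -compA braid_nat !compA braid_nat. Qed.

Lemma dbraid_nat' X X' Z Z' (f : mor X X') (g : mor Z Z') :
  bwd (dbraid X' Z') ∘ (f ⊗m g) = (f ⊗m g) ∘ bwd (dbraid X Z).
Proof. exact/iso_square/dbraid_nat. Qed.

Lemma dbraidA_tens X Y Z A :
  α Y X (Z ⊗ A) ∘ actA (fwd (dbraid (Y ⊗ X) Z)) A
  = (Y ◁ actA (c Z X) A) ∘ actA (fwd (dbraid Y Z)) (X ⊗ A)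
    ∘ (Y ◁ actA (c X Z) A) ∘ α Y X (Z ⊗ A).
Proof.
rewrite !dbraidE !actA_comp !compA braidA_tensr (comp2 (braidA_tensl _ _ _ _)).
by rewrite !compA.
Qed.

Lemma dbraidA_tens' X Y Z A :
  actA (fwd (dbraid (Y ⊗ X) Z)) A ∘ α' Y X (Z ⊗ A)
  = α' Y X (Z ⊗ A) ∘ ((Y ◁ actA (c Z X) A) ∘ actA (fwd (dbraid Y Z)) (X ⊗ A)
    ∘ (Y ◁ actA (c X Z) A)).
Proof.
apply: (iso_epi (i := assoc _ _ _)); apply: (iso_mono (i := assoc _ _ _)).
by rewrite fwdKr dbraidA_tens !compA bwdK comp_idl.
Qed.

Lemma dbraidA_unit X A : actA (fwd (dbraid X 𝟙)) A = \id_(X ⊗ (𝟙 ⊗ A)).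
Proof.
apply: (iso_mono (i := whl_iso X (lunit A))) => /=.
by rewrite comp_idr dbraidE actA_comp compA braidA_unitl braidA_unitr.
Qed.

End DoubleBraiding.

(** * Loops, the Hopf pairing and transparency *)

Section Loops.
Variables (k : fieldType) (C : ribbonCategory k) (L : coend C).
Implicit Types A B U V W X Y Z : C.

Local Notation c X Y := (fwd (braid X Y)).
Local Notation c' X Y := (bwd (braid X Y)).
Local Notation jA X A := (fuseA (cj L X) A).
Local Notation encp := (encircle L (fun X Z => fwd (dbraid X Z))).
Local Notation encm := (encircle L (fun X Z => bwd (dbraid X Z))).
Local Notation loopp := (loop (fun X Z => fwd (dbraid X Z))).
Local Notation loopm := (loop (fun X Z => bwd (dbraid X Z))).

Let dn := @dbraid_nat k C.
Let dn' := @dbraid_nat' k C.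

(** A loop around the left leg of a cap slides over to the right leg, where it is linked by the
    inverse double braiding; [L] has first to be moved past [Z^∨]. *)
Lemma evA_encircle Z A :
  evA Z A ∘ fuseA (encp Z^∨) (Z ⊗ A)
  = evA Z A ∘ (Z^∨ ◁ fuseA (encm Z) A) ∘ actA (c L Z^∨) (Z ⊗ A).
Proof.
apply: jA_epi => X.
rewrite -!compA braidA_fuse encircleA // !compA.
rewrite (comp2 (esym (whl_comp Z^∨ _ _))) encircleA // -[in LHS]evA_nat.
rewrite dbraidE actA_comp whl_comp !compA; congr (_ ∘ _).
apply: (iso_epi (i := whl_iso _ (whl_iso _ (actA_iso (braid Z X) A)))) => /=.
rewrite (comp2 (actA_nat _ _)) !compA.
(* After the crossing of [Z] and [X], the inverse double braiding leaves one inverse crossing, which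
   [braidA_evl] trades for a crossing of [X^∨] and [Z]. *)
have e : evA X (Z ⊗ A) ∘ (X^∨ ◁ actA (bwd (dbraid X Z)) A)
           ∘ (X^∨ ◁ actA (c Z X) A)
         = (Z ◁ evA X A) ∘ actA (c X^∨ Z) (X ⊗ A).
  rewrite -compA -whl_comp -actA_comp dbraidE' fwdKr.
  rewrite -braidA_evl -compA -whl_comp -actA_comp bwdK actA_id.
  by rewrite tensm_id comp_idr.
rewrite (comp2 (esym (whl_comp Z^∨ _ _))) e whl_comp !compA [in RHS]evA_nat.
rewrite !(comp2 (esym (whl_comp X^∨ _ _))) !compA braidA_evl.
by rewrite (comp3 (braidA_evr _ _ _)).
Qed.

Lemma ev_loop (l : mor 𝟙 L) Z : ev Z ∘ (loopp l Z^∨ ▷ Z) = ev Z ∘ (Z^∨ ◁ loopm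
  l Z).
Proof.
apply: capA_inj; rewrite -capA_whl -capA_whm -!/(evA Z _) -!loopA.
by rewrite compA evA_encircle -compA braidA_point -[LHS]compA -whl_comp.
Qed.

Lemma dualm_loop (l : mor 𝟙 L) Z : loopp l Z^∨ = dualm (loopm l Z).
Proof. by apply: ev_inj_l; rewrite ev_loop ev_dualm. Qed.

(** The monodromy in the pairing links [X] with [Z^∨], which is exactly an [X]-coloured loop around
    [Z^∨], closed by a cap. *)
Lemma pairing_cj Z :
  cpairing L ∘ (L ◁ cj L Z) = ev Z ∘ fuseA (encp Z^∨) Z.
Proof.
apply: jA_epi => X; rewrite -!compA encircleA // fuseAE !compA.
rewrite (comp2 (whlr _ _)) cpairingE -[ev X ⊗m _]whlr !compA lunit_nat.
rewrite /coend_monodromy ?compA bwdKr /evA capAE ?compA actAE dbraidE.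
by rewrite ?compA.
Qed.

Lemma pairing_point (l : mor 𝟙 L) Z :
  cpairing L ∘ pointA l L ∘ cj L Z = ev Z ∘ (Z^∨ ◁ loopm l Z).
Proof.
rewrite -ev_loop -compA -pointA_nat compA pairing_cj -compA.
by rewrite loopA.
Qed.

Definition coev_unit : mor 𝟙 (𝟙^∨ : C) := lu 𝟙^∨ ∘ coev 𝟙.

Lemma ev_unit : ev (𝟙 : C) ∘ (coev_unit ▷ 𝟙) = lu 𝟙.
Proof.
apply: capA_inj; rewrite -capA_whl /coev_unit whr_comp -lunit_tens compA.
apply: (iso_epi' (i := lunit (𝟙 ⊗ 𝟙))); rewrite !compA.
rewrite (comp3 (esym (coevAE _ _))) -lunit_nat -compA zigzagA comp_idr.
by rewrite capAE -(comp2 (lunit_tens _ _)) !bwdKr.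
Qed.

(** The unit of the Hopf algebra [L], with [𝟙] identified with [𝟙^∨ ⊗ 𝟙]. *)
Definition coend_unit : mor 𝟙 L := cj L 𝟙 ∘ (coev_unit ▷ 𝟙) ∘ lu' 𝟙.

(** A loop around the unit object unlinks, by [dbraidA_unit], and leaves only the counit. *)
Lemma pairing_unit : cpairing L ∘ (L ◁ coend_unit) = lu 𝟙 ∘ (ccounit L ▷ 𝟙).
Proof.
rewrite /coend_unit !whl_comp !compA pairing_cj (comp2 (fuseA_whm _ _ _)).
rewrite encircle_nat // -whr_fuseA.
have -> : fuseA (encp 𝟙) 𝟙 = lu (𝟙 ⊗ 𝟙) ∘ (ccounit L ▷ (𝟙 ⊗ 𝟙)).
  apply: jA_epi => X; rewrite encircleA // dbraidA_unit tensm_id comp_idr.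
  by rewrite counitA_jA.
rewrite !compA ev_unit (comp2 (exch _ _)) !compA (comp2 (lunit_nat _)).
by rewrite compA bwdK comp_idl.
Qed.

Hypothesis nondeg : nondegenerate_pairing (cpairing L).

Lemma pairing_inj_r U (f g : mor U L) :
  cpairing L ∘ (L ◁ f) = cpairing L ∘ (L ◁ g) -> f = g.
Proof.
have [i iE] := nondeg; rewrite -(ev_mate (cpairing L)) -iE -!compA !exch !compA.
by move/(@iso_epi _ _ _ _ (whr_iso _ i)) => /ev_inj_r.
Qed.

Lemma pairing_point_eq0 (l : mor 𝟙 L) : cpairing L ∘ pointA l L = 0 -> l = 0.
Proof.
have [i iE] := nondeg.
rewrite pointAE compA => e; apply: (iso_mono (i := i)); rewrite comp0r.
apply: ev_inj_l; rewrite whr_comp compA iE ev_mate tensm0l comp0r.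
by apply: (iso_epi' (i := lunit _)); rewrite e comp0l.
Qed.

(** The loops coloured by [l] are the components of the pairing with [l], so non-degeneracy recovers
    [l] from them. *)
Lemma loopp_eq0 (l : mor 𝟙 L) : (forall Z, loopp l Z = 0) -> l = 0.
Proof.
move=> l0; apply: pairing_point_eq0; apply: cj_epi => Z.
by rewrite pairing_point -ev_loop l0 tensm0l comp0r comp0l.
Qed.

Lemma loopm_eq0 (l : mor 𝟙 L) : (forall Z, loopm l Z = 0) -> l = 0.
Proof.
move=> l0; apply: pairing_point_eq0; apply: cj_epi => Z.
by rewrite pairing_point l0 tensm0r comp0r comp0l.
Qed.

Variable Lam : mor 𝟙 L.
Hypothesis Lam_integral : cmul L ∘ (Lam ▷ L) = Lam ∘ ccounit L ∘ lu L.

(** Both framings at once: [h] is the twist or its inverse, [d] the matching double braiding, [T]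
    the map induced on [L]. The balancing equation for [h (Y ⊗ X)] shows that sliding [X] through
    the framed loop links it by [d] and adds one [h] on [X]. *)
Lemma loop_framed (d : forall X Z : C, mor (X ⊗ Z) (X ⊗ Z))
    (h : forall X : C, mor X X) (T : mor L L) s :
  (forall X X' Z Z' (f : mor X X') (g : mor Z Z'),
    d X' Z' ∘ (f ⊗m g) = (f ⊗m g) ∘ d X Z) ->
  (forall X Y, h (Y ⊗ X) = d Y X ∘ (h Y ⊗m h X)) ->
  (forall X, T ∘ cj L X = cj L X ∘ (X^∨ ◁ h X)) ->
  ccounit L ∘ T ∘ Lam = s *: \id_𝟙 ->
  forall X, loop d (T ∘ Lam) X ∘ h X = s *: \id_X.
Proof.
move=> d_nat hd Th TLam X; apply: ev_inj_r; apply: capA_inj.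
rewrite -!capA_whm -/(evA X 𝟙).
pose F := lu 𝟙 ∘ ((ccounit L ∘ T) ▷ 𝟙).
pose G := evA X 𝟙 ∘ (X^∨ ◁ (fuseA (encircle L d X) 𝟙 ∘ (T ⊗m (h X ▷ 𝟙)))).
have TA A B (g : mor A B) : T ⊗m g = (T ▷ B) ∘ (L ◁ g) by rewrite whrl.
have : G ∘ (X^∨ ◁ pointA Lam (X ⊗ 𝟙)) = F ∘ pointA Lam 𝟙 ∘ evA X 𝟙.
  apply: (integral_slide Lam_integral) => Y.
  have -> : F ∘ jA (Y ⊗ X) 𝟙
            = evA (Y ⊗ X) 𝟙 ∘ ((Y ⊗ X)^∨ ◁ (h (Y ⊗ X) ▷ 𝟙)).
    rewrite /F whr_comp (comp2 (esym (compA _ _ _))) !compA.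
    by rewrite (comp2 (whr_fuseA _ _ _)) Th -fuseA_whm compA counitA_jA.
  rewrite (comp2 (esym (whl_comp _ _ _))) -assoc_actA whl_comp !compA.
  rewrite (comp2 (esym (fuseA_nat _ _))) !compA evA_dual_tens.
  rewrite hd actA_comp actA_tens -!compA -!whl_comp -compA TA -compA.
  rewrite -fuseA_nat (compA (T ▷ _)) whr_fuseA Th -fuseA_whm !compA.
  by rewrite encircleA // -!compA -!whl_comp whrl.
rewrite /G -compA -whl_comp TA !compA (comp2 (pointA_nat _ _)) !compA.
rewrite (comp2 (whr_pointA _ _ _)) loopA -whr_comp => ->.
rewrite /F (comp2 (whr_pointA _ _ _)) TLam pointAE tensmZl tensm_id compZl
  compZr.
by rewrite comp_idl bwdK tensmZl tensm_id tensmZr tensm_id compZl compZr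
  comp_idl comp_idr.
Qed.

Hypothesis Lam_neq0 : Lam <> 0.

(** If [s] were 0, [loop_framed] and the invertibility of the twist would kill every loop coloured
    by the twisted integral, hence that integral, hence [Lam]. *)
Lemma framed_unknot_neq0 s :
  ccounit L ∘ fwd (ctwist L) ∘ Lam = s *: \id_𝟙 -> s != 0.
Proof.
move=> sE; apply/eqP => s0; apply: Lam_neq0; apply: (iso_mono (i := ctwist L)).
rewrite comp0r; apply: loopp_eq0 => Z; apply: (iso_epi (i := twist Z)).
rewrite (loop_framed (h := fun X => fwd (twist X)) _ _ (ctwistE L) sE) //.
  by rewrite s0 scale0r comp0l.
by move=> X Y; rewrite twist_tens dbraidE.
Qed.

Lemma framed_unknot_neq0' s :
  ccounit L ∘ bwd (ctwist L) ∘ Lam = s *: \id_𝟙 -> s != 0.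
Proof.
move=> sE; apply/eqP => s0; apply: Lam_neq0; apply: (iso_mono' (i := ctwist L)).
rewrite comp0r; apply: loopm_eq0 => Z; apply: (iso_epi' (i := twist Z)).
rewrite (loop_framed (h := fun X => bwd (twist X)) _ _ _ sE) //.
- by rewrite s0 scale0r comp0l.
- move=> X Y; apply: (iso_mono (i := twist (Y ⊗ X))); rewrite bwdK twist_tens.
  rewrite -dbraidE dbraid_nat' !compA (comp2 (esym (tensm_comp _ _ _ _))).
  by rewrite !bwdK tensm_id comp_idr bwdK.
move=> X; apply: (iso_mono (i := ctwist L)).
by rewrite !compA bwdK comp_idl ctwistE -compA -whl_comp bwdK tensm_id comp_idr.
Qed.

(** A handle slide: a loop that encircles [Z] next to a [Lam]-coloured loop can be slid through the
    latter and comes off [Z]. *)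
Lemma loop_transparent Z A :
  fuseA (encp Z) A ∘ (L ◁ (loopp Lam Z ▷ A))
  = (loopp Lam Z ▷ A) ∘ lu (Z ⊗ A) ∘ (ccounit L ▷ (Z ⊗ A)).
Proof.
apply: jA_epi => X.
(* [dbraidA_tens'] splits the double braiding of [Y ⊗ X] with [Z] into that of [Y] with [Z] between
   two crossings of [X] and [Z]; [G] has this shape with [Y] integrated. *)
pose G := evA X (Z ⊗ A) ∘ (X^∨ ◁ (actA (c Z X) A ∘ fuseA (encp Z) (X ⊗ A)
                                   ∘ (L ◁ actA (c X Z) A))).
have : G ∘ (X^∨ ◁ pointA Lam (X ⊗ (Z ⊗ A)))
       = fuseA (encp Z) A ∘ pointA Lam (Z ⊗ A) ∘ evA X (Z ⊗ A).
  apply: (integral_slide Lam_integral) => Y; rewrite encircleA //.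
  rewrite (comp2 (esym (whl_comp _ _ _))) dbraidA_tens' whl_comp !compA.
  rewrite (comp2 (esym (fuseA_nat _ _))) !compA evA_dual_tens.
  rewrite /G -!compA -!whl_comp -!compA -fuseA_nat (compA (fuseA _ _))
    encircleA //.
  by rewrite !compA -[in LHS]evA_nat -!compA -!whl_comp.
rewrite /G -compA -whl_comp (comp2 (pointA_nat _ _)) !compA.
rewrite (comp2 (loopA _ _ _ _)) (comp2 (esym (braidA_natr _ _ _))) !compA.
rewrite -actA_comp -dbraidE loopA => e.
rewrite (comp2 (esym (fuseA_nat _ _))) !compA encircleA // -compA -whl_comp e.
by rewrite (comp3 (counitA_jA _ _ _)).
Qed.

(** Dinaturality and [dualm_loop] move the loop to [Z^∨]. Paired with [L], both sides then agree by
    [loop_transparent], and non-degeneracy removes the pairing. *)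
Lemma cointegral Z :
  cj L Z ∘ (Z^∨ ◁ loopm Lam Z) = coend_unit ∘ ev Z ∘ (Z^∨ ◁ loopm Lam Z).
Proof.
rewrite -cj_dinatural -[RHS]compA -ev_dualm -dualm_loop.
apply: pairing_inj_r; rewrite 2!whl_comp !compA pairing_cj pairing_unit.
by rewrite (comp2 (loop_transparent _ _)) (comp2 (exch _ _)) !compA lunit_nat.
Qed.

Lemma cointegral_dinatural V (phi : forall X : C, mor (X^∨ ⊗ X) V) Z :
  dinatural phi ->
  phi Z ∘ (Z^∨ ◁ loopm Lam Z)
  = phi 𝟙 ∘ (coev_unit ▷ 𝟙) ∘ lu' 𝟙 ∘ (ev Z ∘ (Z^∨ ◁ loopm Lam Z)).
Proof.
move=> /(@cj_universal _ _ L) [f [fE _]].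
by rewrite -!fE -compA cointegral /coend_unit !compA.
Qed.

Lemma loopm_neq0 : exists Z, loopm Lam Z <> 0.
Proof.
apply: contrapT => no; apply: Lam_neq0.
by apply: loopm_eq0 => Z; apply: contrapT => Z0; apply: no; exists Z.
Qed.

(** Pairing [Lam] with [coend_unit] identifies the loop at the unit object with
    [ccounit L ∘ Lam]. *)
Lemma loopm_unit : ev (𝟙 : C) ∘ (𝟙^∨ ◁ loopm Lam 𝟙) ∘ (coev_unit ▷ 𝟙) ∘ lu' 𝟙
  = lu 𝟙 ∘ ((ccounit L ∘ Lam) ▷ 𝟙) ∘ lu' 𝟙.
Proof.
rewrite -pairing_point -!compA (compA (cj L 𝟙)) -/coend_unit.
by rewrite -pointA_nat compA pairing_unit -compA whr_pointA pointAE.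
Qed.

End Loops.

(** * Finite linear categories *)

Section LinearAlgebra.

Lemma eigenvector_ex (k : closedFieldType) (V : vectType k) (u : V)
    (f : V -> V) :
  u != 0 -> linear f -> exists c v, v != 0 /\ f v = c *: v.
Proof.
move=> u0 flin.
pose fL := GRing.isLinear.Build k V V *:%R f flin.
pose F : {linear V -> V} := HB.pack f fL.
pose A := lin1_mx (v2r \o F \o r2v).
have n_gt0 : (0 < dim V)%N.
  rewrite lt0n; apply: contraNneq u0 => n0.
  by rewrite -(v2rK u); apply/eqP; rewrite [v2r u](_ : _ = 0) ?linear0 //;
    apply/rowP => i; have := ltn_ord i; rewrite [X in (_ < X)%N]n0.
have /closed_rootP [c] : size (char_poly A) != 1%N.
  by rewrite size_char_poly; case: (dim V) n_gt0.
rewrite -eigenvalue_root_char => /eigenvalueP [v vA v0].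
exists c, (r2v v); split.
  by apply: contraNneq v0 => /(congr1 v2r); rewrite r2vK linear0 => ->.
by apply: (can_inj v2rK); rewrite linearZ /= r2vK -vA mul_rV_lin1.
Qed.

(** The second hypothesis is linear independence of the functionals [b^~ i], so their matrix in a
    basis of [V] has full row rank and a right inverse. *)
Lemma separating_surjective (k : fieldType) (V : vectType k) n
    (b : V -> 'I_n -> k) :
  (forall i, linear (b^~ i : V -> k^o)) ->
  (forall c : 'I_n -> k,
     (forall x, \sum_i c i * b x i = 0) -> forall i, c i = 0) ->
  forall y : 'I_n -> k, exists x, forall i, b x i = y i.
Proof.
move=> blin sep y.
have bE i (s : 'I_(\dim {:V}) -> k) (e : 'I_(\dim {:V}) -> V) :
    b (\sum_p s p *: e p) i = \sum_p s p * b (e p) i.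
  pose bL := GRing.isLinear.Build k V k^o *:%R (b^~ i) (blin i).
  pose F : {linear V -> k^o} := HB.pack (b^~ i) bL.
  by rewrite -[LHS]/(F _) linear_sum; apply: eq_bigr => p _; rewrite linearZ.
pose A := \matrix_(i < n, p < \dim {:V}) b (vbasis fullv)`_p i.
have /row_freeP [B AB] : row_free A.
  apply: inj_row_free => c cA; apply/rowP => i; rewrite mxE.
  apply: (sep (c 0)) => x; rewrite (coord_vbasis (memvf x)).
  under eq_bigr do rewrite bE mulr_sumr.
  rewrite exchange_big big1 //= => p _.
  have /rowP/(_ p) := cA; rewrite !mxE => cAp.
  transitivity (coord (vbasis fullv) p x * \sum_i c 0 i * A i p).
    by rewrite mulr_sumr; apply: eq_bigr => j _; rewrite mxE mulrCA.
  by rewrite cAp mulr0.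
exists (\sum_p (\sum_j B p j * y j) *: (vbasis fullv)`_p) => i; rewrite bE.
under eq_bigr do rewrite mulr_suml.
rewrite exchange_big /=.
transitivity (\sum_j (A *m B) i j * y j).
  apply: eq_bigr => j _; rewrite mxE mulr_suml; apply: eq_bigr => p _.
  by rewrite mxE mulrC mulrA.
rewrite AB (bigD1 i) //= big1 ?mxE ?eqxx ?mul1r ?addr0 // => j ji.
by rewrite mxE eq_sym (negbTE ji) mul0r.
Qed.

End LinearAlgebra.

(** * Simple objects and Schur's lemma *)

Section Abelian.
Variables (k : closedFieldType) (C : linearCategory k).
Hypothesis ab : abelian_category C.
Implicit Types S T U V W X Y Z : C.

Lemma is_zero_mor_r X Y (f : mor X Y) : is_zero Y -> f = 0.
Proof. by move=> Y0; rewrite -[f]comp_idl Y0 comp0l. Qed.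

Lemma is_zero_mor_l X Y (f : mor X Y) : is_zero X -> f = 0.
Proof. by move=> X0; rewrite -[f]comp_idr X0 comp0r. Qed.

Lemma monicP X Y (f : mor X Y) :
  (forall W (g : mor W X), f ∘ g = 0 -> g = 0) -> monic f.
Proof.
move=> f0 W g h e; apply/eqP; rewrite -subr_eq0; apply/eqP/f0.
by rewrite compBr e subrr.
Qed.

Lemma epicP X Y (f : mor X Y) :
  (forall Z (g : mor Y Z), g ∘ f = 0 -> g = 0) -> epic f.
Proof.
move=> f0 W g h e; apply/eqP; rewrite -subr_eq0; apply/eqP/f0.
by rewrite compBl e subrr.
Qed.

Lemma kernel_monic X Y K (f : mor X Y) (i : mor K X) : is_kernel f i -> monic i.
Proof.
case=> fi0 ku; apply: monicP => W g ig0.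
have [|h [_ hu]] := ku W 0; first by rewrite comp0r.
by rewrite -(hu g ig0) -(hu 0) ?comp0r.
Qed.

Lemma cokernel_epic X Y Q (f : mor X Y) (q : mor Y Q) :
  is_cokernel f q -> epic q.
Proof.
case=> qf0 cu; apply: epicP => W g gq0.
have [|h [_ hu]] := cu W 0; first by rewrite comp0l.
by rewrite -(hu g gq0) -(hu 0) ?comp0l.
Qed.

Lemma simple_monic S Y (f : mor S Y) : simple_object S -> f <> 0 -> monic f.
Proof.
move=> [S0 Ss] f0; have [K [i ik]] := kernel_ex ab f.
have [fi0 ku] := ik; case: (Ss _ i (kernel_monic ik)) => [K0|[j jE]].
  apply: monicP => W g fg0; have [h [<- _]] := ku _ g fg0.
  by rewrite (is_zero_mor_l i K0) comp0l.
by case: f0; apply: (iso_epi (i := j)); rewrite jE fi0 comp0l.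
Qed.

Lemma simple_epic X S (f : mor X S) : simple_object S -> f <> 0 -> epic f.
Proof.
move=> [S0 Ss] f0; have [Q [q [qf0 qu]]] := cokernel_ex ab f.
have [I [i ik]] := kernel_ex ab q; have [qi0 iu] := ik.
have [g [fE _]] := iu _ f qf0.
case: (Ss _ i (kernel_monic ik)) => [I0|[j jE]].
  by case: f0; rewrite -fE (is_zero_mor_l i I0) comp0l.
have q0 : q = 0 by apply: (iso_epi (i := j)); rewrite jE qi0 comp0l.
apply: epicP => Z h hf0; have [h' [<- _]] := qu _ h hf0.
by rewrite q0 comp0r.
Qed.

Lemma simple_iso S T (f : mor S T) :
  simple_object S -> simple_object T -> f <> 0 -> is_iso f.
Proof.
move=> Ss Ts f0; case: (Ts) => _ /(_ _ _ (simple_monic Ss f0)) [|//].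
by case: (Ss).
Qed.

(** An eigenvector of composition with [f] on the endomorphisms of [S] is killed by
    [f - c *: \id_S], which is then not monic and so vanishes. *)
Lemma schur S (f : mor S S) : simple_object S -> exists c, f = c *: \id_S.
Proof.
move=> Ss; have id0 : \id_S != 0 by apply/eqP; case: Ss.
have [c [g [g0 fg]]] := eigenvector_ex id0 (comp_linear_r f).
exists c; apply: contrapT => fc; move/eqP: g0; apply.
have fc0 : f - c *: \id_S <> 0.
  by move=> /eqP; rewrite subr_eq0 => /eqP /fc.
apply: (simple_monic Ss fc0).
by rewrite comp0r compBl compZl comp_idl fg subrr.
Qed.

(** Induction by restricting to the kernel of the first [v]. The others stay independent there: a
    combination vanishing on the kernel factors through [v ord0], so by Schur it is a multiple of
    [v ord0]. *)
Lemma simple_joint_epic S m : simple_object S ->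
  forall G (v : 'I_m -> mor G S),
    (forall c : 'I_m -> k, \sum_i c i *: v i = 0 -> forall i, c i = 0) ->
  forall Z (g : 'I_m -> mor S Z), \sum_i (g i ∘ v i) = 0 -> forall i, g i = 0.
Proof.
move=> Ss; elim: m => [|m IH] G v vfree Z g; first by move=> _ [].
rewrite big_ord_recl => gv.
have v0 : v ord0 <> 0.
  move=> v0; have := vfree (fun i => (i == ord0)%:R) _ ord0.
  rewrite eqxx => e; have /eqP := oner_neq0 k; apply; apply: e.
  rewrite big_ord_recl v0 scaler0 add0r big1 // => j _.
  by rewrite eq_sym (negbTE (neq_lift _ _)) scale0r.
have [K [i ik]] := kernel_ex ab (v ord0); have [vi0 iu] := ik.
have [W [w [vw0 wu]]] := epic_conormal ab (simple_epic Ss v0).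
have vifree (c : 'I_m -> k) :
    \sum_j c j *: (v (lift ord0 j) ∘ i) = 0 -> forall j, c j = 0.
  under eq_bigr do rewrite -compZl; rewrite -comp_suml => ci0.
  have [w' [wE _]] := iu _ w vw0.
  have [|s [sE _]] := wu _ (\sum_j c j *: v (lift ord0 j)).
    by rewrite -wE compA ci0 comp0l.
  have [a sa] := schur s Ss.
  pose c' i := if unlift ord0 i is Some j then c j else - a.
  have c'0 : \sum_i c' i *: v i = 0.
    rewrite big_ord_recl /c' unlift_none -[X in _ + X = 0](_ : s ∘ v ord0 = _).
      by rewrite sa compZl comp_idl scaleNr addNr.
    by rewrite sE; apply: eq_bigr => j _; rewrite liftK.
  by move=> j; have := vfree c' c'0 (lift ord0 j); rewrite /c' liftK.
have g0 j : g (lift ord0 j) = 0.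
  move: j; apply: (IH _ _ vifree).
  have := congr1 (fun u => u ∘ i) gv.
  rewrite compDl -compA vi0 comp0r add0r comp_suml comp0l => e; rewrite -[RHS]e.
  by apply: eq_bigr => j _; rewrite compA.
move=> j; case: (unliftP ord0 j) => [j' ->|->]; first exact: g0.
apply: (simple_epic Ss v0); rewrite comp0l -[RHS]gv big1 ?addr0 // => j' _.
by rewrite g0 comp0l.
Qed.

End Abelian.

Lemma dependent_choice_ex A (B : A -> Type) (P : forall a, B a -> Prop) :
  (forall a, exists b, P a b) -> exists f, forall a, P a (f a).
Proof. by move=> e; exists (fun a => sval (cid (e a))) => a; apply: svalP. Qed.

(** * Projective generators and presentations *)

Section Finite.
Variables (k : closedFieldType) (C : linearCategory k).
Hypothesis fin : finite_category C.
Implicit Types S T U V W X Y Z : C.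

Let ab := finite_abelian fin.

Lemma simple_quotient X :
  ~ is_zero X -> exists S (q : mor X S), simple_object S /\ epic q.
Proof.
case: X / (finite_lengths fin X) => [X //|Y X Q i q mi cq Qs _ _].
by exists Q, q; split=> //; apply: cokernel_epic cq.
Qed.

Lemma direct_sum_projective n (P : 'I_n -> C) X :
  (forall a, projective (P a)) -> is_direct_sum X P -> projective X.
Proof.
move=> Pp [i [p [_ _ ip]]] Y Z e f eepi.
have /dependent_choice_ex [g gE] : forall a, exists g, e ∘ g = f ∘ i a.
  by move=> a; apply: Pp.
exists (\sum_a (g a ∘ p a)); rewrite comp_sumr -[RHS]comp_idr -ip comp_sumr.
by apply: eq_bigr => a _; rewrite !compA gE.
Qed.

Definition separator G := forall W Z (u : mor W Z),
  (forall h : mor G W, u ∘ h = 0) -> u = 0.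

(** [G] is a sum of projectives mapping onto the simples. If [u] is not 0, its coimage has a simple
    quotient; the map to it from some [P a] lifts to [W], but [u] kills the lift, which therefore
    vanishes in the coimage. *)
Lemma projective_separator_ex : exists G : C, projective G /\ separator G.
Proof.
have [n [S Sall]] := finitely_many_simples fin.
have /dependent_choice_ex [P Pe] : forall a, exists P, exists e : mor P (S a),
    projective P /\ epic e by move=> a; exact: enough_projectives.
have [G GP] := direct_sum_ex ab P; exists G; split.
  by apply: direct_sum_projective GP => a; have [e []] := Pe a.
move=> W Z u uh; apply: contrapT => u0.
have [K [i ik]] := kernel_ex ab u; have [ui0 iu] := ik.
have [I [c ck]] := cokernel_ex ab i; have [ci0 cu] := ck.
have [|Q [q [Qs qepi]]] := @simple_quotient I.
  move=> I0; have [v [vE _]] := cu _ u ui0.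
  by apply: u0; rewrite -vE (is_zero_mor_r c I0) comp0r.
have [a [f]] := Sall Q Qs; have [e [Pp eepi]] := Pe a.
have [g gE] : exists g : mor (P a) W, (q ∘ c) ∘ g = bwd f ∘ e.
  apply: Pp => T x y; rewrite !compA => xy.
  by apply: qepi; apply: (cokernel_epic ck).
have [j [p [pj _ _]]] := GP.
have [w [wE _]] : exists! w, i ∘ w = g.
  by apply: iu; rewrite -[g]comp_idr -(pj a) (compA g) (compA u) uh comp0l.
case: Qs => Q0 _; apply: Q0; rewrite /is_zero -(fwdK f).
suff -> : bwd f = 0 by rewrite comp0l.
apply: eepi; rewrite comp0l -gE -wE -[q ∘ c ∘ _]compA (compA c).
by rewrite ci0 comp0l comp0r.
Qed.

(** The [f a] make [X] a quotient of the sum of the [P a]; that the relations are respected can be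
    tested on morphisms from [G]. *)
Lemma joint_quotient n (P : 'I_n -> C) X Z (f : forall a, mor (P a) X)
    (g : forall a, mor (P a) Z) G :
  separator G ->
  (forall W (u : mor X W), (forall a, u ∘ f a = 0) -> u = 0) ->
  (forall h : forall a, mor G (P a),
     \sum_a (f a ∘ h a) = 0 -> \sum_a (g a ∘ h a) = 0) ->
  exists t : mor X Z, forall a, t ∘ f a = g a.
Proof.
move=> Gs fepi fg; have [D [i [p [pi pi0 ip]]]] := direct_sum_ex ab P.
have piE Y (v : forall a, mor (P a) Y) a : (\sum_b (v b ∘ p b)) ∘ i a = v a.
  rewrite comp_suml (bigD1 a) //= -compA pi comp_idr big1 ?addr0 // => b ba.
  by rewrite -compA pi0 ?comp0r //; apply/eqP.
pose F := \sum_a (f a ∘ p a); pose H := \sum_a (g a ∘ p a).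
have Fepi : epic F.
  apply: epicP => W u uF; apply: fepi => a.
  by rewrite -(piE _ f) compA uF comp0l.
have [W [w [Fw0 wu]]] := epic_conormal ab Fepi.
have [|t [tE _]] := wu _ H.
  apply: Gs => h; rewrite /H 2!comp_suml.
  under eq_bigr do rewrite -2!compA.
  apply: fg; have := congr1 (fun u => u ∘ h) Fw0.
  rewrite /F 2!comp_suml comp0l => e; rewrite -[RHS]e.
  by apply: eq_bigr => a _; rewrite !compA.
by exists t => a; rewrite -(piE _ f) compA tE piE.
Qed.

End Finite.

Section Extension.
Variables (k : closedFieldType) (C : rigidCategory k).
Hypothesis fin : finite_category C.
Implicit Types G S T U V W X Y Z : C.

(* A right exact functor is determined by its value on a generator together
   with the action of the endomorphisms of the latter. *)
Lemma natural_extension G V (a : mor G (G ⊗ V)) :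
  separator G -> (forall f : mor G G, a ∘ f = (f ▷ V) ∘ a) ->
  exists b : forall X, mor X (X ⊗ V),
    (forall X Y (f : mor X Y), b Y ∘ f = (f ▷ V) ∘ b X) /\ b G = a.
Proof.
move=> Gs anat.
have /dependent_choice_ex [b bE] : forall X, exists b : mor X (X ⊗ V),
    forall f : mor G X, b ∘ f = (f ▷ V) ∘ a.
  (* A basis of the morphisms from [G] to [X] presents [X] as a quotient of a power of [G];
     compatibility of [a] with endomorphisms makes [b] respect the relations. *)
  move=> X; pose e := vbasis {: mor G X}.
  have eE (f : mor G X) : f = \sum_i coord e i f *: e`_i.
    exact: (coord_vbasis (memvf f)).
  have [||b bE] := @joint_quotient _ _ fin _ (fun _ => G) X (X ⊗ V)
      (fun i : 'I_(\dim {: mor G X}) => e`_i) (fun i => (e`_i ▷ V) ∘ a) G Gs.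
  - move=> W u u0; apply: Gs => h; rewrite [h]eE comp_sumr big1 // => i _.
    by rewrite compZr u0 scaler0.
  - move=> h eh; under eq_bigr do rewrite -compA anat compA -whr_comp.
    by rewrite -comp_suml -tensm_suml eh tensm0l comp0l.
  exists b => f; rewrite [f]eE comp_sumr tensm_suml comp_suml.
  by apply: eq_bigr => i _; rewrite compZr bE tensmZl compZl.
exists b; split; last by rewrite -[LHS]comp_idr bE tensm_id comp_idl.
move=> X Y f; apply/eqP; rewrite -subr_eq0; apply/eqP/Gs => h.
by rewrite compBl -!compA !bE whr_comp !compA subrr.
Qed.

End Extension.

(** * Minimal left ideals of an endomorphism algebra and their duals *)

Section Nakayama.
Variables (k : closedFieldType) (C : linearCategory k).
Hypothesis fin : finite_category C.
Implicit Types S T U V W X Y Z : C.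

Let ab := finite_abelian fin.

Variables (G : C) (q : mor G G).
Hypothesis Gproj : projective G.
Hypothesis q_neq0 : q <> 0.
Hypothesis q_central : forall a : mor G G, q ∘ a = a ∘ q.

Let A := mor G G.

Let compr (d : A) : {linear A -> A} :=
  HB.pack (fun a : A => a ∘ d)
    (GRing.isLinear.Build k A A *:%R (fun a : A => a ∘ d) (comp_linear_l d)).

Let left_ideal (D : {vspace A}) :=
  [/\ D != 0%VS, forall a d : A, d \in D -> a ∘ d \in D
    & forall d, d \in D -> exists b, d = q ∘ b].

Let cyclic d : d <> 0 -> (exists b, d = q ∘ b) -> left_ideal (limg (linfun
  (compr d))).
Proof.
move=> d0 [b db]; split.
- apply/eqP => D0; apply/d0/eqP; rewrite -memv0 -D0; apply/memv_imgP.
  by exists (idm G); rewrite ?memvf // lfunE /= comp_idl.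
- move=> a _ /memv_imgP [x _ ->]; apply/memv_imgP.
  by exists (a ∘ x); rewrite ?memvf // !lfunE /= compA.
- move=> _ /memv_imgP [x _ ->]; rewrite lfunE /= db.
  by exists (x ∘ b); rewrite compA -q_central -compA.
Qed.

(* If D is a minimal left ideal of A = End G inside A q, with dual right module
   D*, then S is the simple quotient of the object corresponding to D*, and the
   v i are the images of the basis of D* dual to d. *)
Lemma simple_dual_ex :
  exists (S : C) m (d : 'I_m -> A) (v : 'I_m -> mor G S)
    (r : A -> 'I_m -> 'I_m -> k),
    [/\ simple_object S, exists2 i, d i <> 0 & forall i, exists b, d i = q ∘ b,
      forall c : 'I_m -> k, \sum_i c i *: v i = 0 -> forall i, c i = 0,
      forall a i, a ∘ d i = \sum_l r a i l *: d l
    & forall a j, v j ∘ a = \sum_i r a i j *: v i].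
Proof.
have ex : exists n, `[<exists D, left_ideal D /\ \dim D = n>].
  exists (\dim (limg (linfun (compr q)))); apply/asboolP.
  eexists; split; last reflexivity.
  by apply: cyclic => //; exists (idm G); rewrite comp_idr.
case: (ex_minnP ex) => n /asboolP [D [[D0 Dl Dq] Dn]] nmin.
pose b := vbasis D.
have bD i : b`_i \in D.
  case: (ltnP i (\dim D)) => [lt|ge]; last by rewrite nth_default ?mem0v
    ?size_tuple.
  by apply/vbasis_mem/mem_nth; rewrite size_tuple.
(* By minimality of the dimension every non-zero element generates [D]. *)
have cyc d d' : d \in D -> d <> 0 -> d' \in D -> exists a, d' = a ∘ d.
  move=> dD d0 d'D; have Dd := cyclic d0 (Dq d dD).
  have sub : (limg (linfun (compr d)) <= D)%VS.
    by apply/subvP => _ /memv_imgP [x _ ->]; rewrite lfunE /=; apply: Dl.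
  have /eqP E : limg (linfun (compr d)) == D.
    rewrite eqEdim sub Dn /=; apply: nmin; apply/asboolP.
    by exists (limg (linfun (compr d))).
  by move: d'D; rewrite -E => /memv_imgP [x _ ->]; exists x; rewrite lfunE.
have m_gt0 : (0 < \dim D)%N by rewrite lt0n dimv_eq0.
pose i0 := Ordinal m_gt0; pose t : A -> k := coord b i0.
have tZ e x : t (e *: x) = e * t x by rewrite /t linearZ.
have tD x y : t (x + y) = t x + t y by rewrite /t linearD.
have tB x y : t (x - y) = t x - t y by rewrite /t linearB.
have tsum (I : finType) (f : I -> A) : t (\sum_i f i) = \sum_i t (f i).
  by rewrite /t linear_sum.
have tlin (a0 d : A) : linear (fun x : A => t (a0 ∘ x ∘ d) : k^o).
  by move=> c x y; rewrite compDr compZr compDl compZl tD tZ.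
have t0 : t b`_i0 = 1 by rewrite /t coord_free ?eqxx ?(basis_free (vbasisP D)).
(* The dual of [D] is a simple right module: a functional [t (a0 ∘ -)] that is non-zero on [D]
   generates it. Otherwise a linear relation gives a [d] in [D] with all [t (a0 ∘ x ∘ d)] zero,
   although a non-zero [d] generates [D]. *)
have surj (a0 : A) : (exists2 d, d \in D & t (a0 ∘ d) <> 0) ->
    forall y : 'I_(\dim D) -> k, 
      exists x, forall i : 'I_(\dim D), t (a0 ∘ x ∘ b`_i) = y i.
  move=> [d1 d1D td1]; apply: separating_surjective; first by move=> i; apply:
    tlin.
  move=> c ct; pose d := \sum_i c i *: b`_i.
  have tx x : t (a0 ∘ x ∘ d) = 0.
    rewrite -[RHS](ct x) /d comp_sumr tsum; apply: eq_bigr => i _.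
    by rewrite compZr tZ.
  have d0 : d = 0.
    apply: contrapT => d0; apply: td1.
    have [|x ->] := cyc d d1 _ d0 d1D; last by rewrite compA tx.
    by apply: rpred_sum => i _; apply/rpredZ/bD.
  by move=> i; have /freeP := basis_free (vbasisP D); apply.
pose phi0 (a : A) : 'rV[k]_(\dim D) := \row_i t (a ∘ b`_i).
have phi_lin : linear phi0.
  move=> c x y; apply/rowP => i; rewrite !mxE compDl compZl.
  by rewrite tD tZ.
pose phi : {linear A -> 'rV[k]_(\dim D)} := HB.pack phi0
  (GRing.isLinear.Build k A 'rV[k]_(\dim D) *:%R phi0 phi_lin).
(* [R] is a right ideal whose quotient is the dual of [D]; [S'] below is the quotient of [G] by
   [R]. *)
pose R := lker (linfun phi).
have RP a : reflect (forall i : 'I_(\dim D), t (a ∘ b`_i) = 0) (a \in R).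
  rewrite memv_ker lfunE; apply: (iffP eqP) => [/rowP a0 i|a0].
    by have := a0 i; rewrite !mxE.
  by apply/rowP => i; rewrite !mxE.
have RD a : a \in R -> forall d, d \in D -> t (a ∘ d) = 0.
  move=> /RP aR d /coord_vbasis ->; rewrite comp_sumr tsum big1 // => i _.
  by rewrite compZr tZ aR mulr0.
pose r0 (p : 'I_(\dim R)) : A := (vbasis R)`_p.
have r0R p : r0 p \in R by apply/vbasis_mem/mem_nth; rewrite size_tuple.
have [H [i [p [pi pi0 ip]]]] := direct_sum_ex ab (fun _ : 'I_(\dim R) => G).
pose psi := \sum_a (r0 a ∘ p a).
have [S' [c ck]] := cokernel_ex ab psi; have [cpsi cu] := ck.
have cR a : a \in R -> c ∘ a = 0.
  move=> /coord_vbasis ->; rewrite comp_sumr big1 // => j _; rewrite compZr.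
  suff -> : c ∘ (vbasis R)`_j = 0 by rewrite scaler0.
  rewrite -[_`_j]/(r0 j) -[r0 j]comp_idr -(pi j).
  transitivity (c ∘ psi ∘ i j); last by rewrite cpsi comp0l.
  rewrite /psi -compA comp_suml (bigD1 j) //= big1 ?addr0 ?compA // => l lj.
  by rewrite -compA pi0 ?comp0r //; apply/eqP.
have [|S [s [Ss sepi]]] := simple_quotient fin (X := S').
  (* Otherwise projectivity of [G] lifts the identity through [psi] and so puts it in [R], against
     [t0]. *)
  move=> S'0; have psi_epi : epic psi.
    apply: epicP => Z g gpsi; have [u [<- _]] := cu _ g gpsi.
    by rewrite (is_zero_mor_r c S'0) comp0r.
  have [u uE] := Gproj \id_G psi_epi.
  have := RD \id_G _ b`_i0 (bD i0); rewrite comp_idl t0 => e.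
  have /eqP := oner_neq0 k; apply; apply: e.
  rewrite -uE /psi comp_suml; apply: rpred_sum => a _; apply/RP => l.
  by rewrite -2!compA (compA (p a)) RD ?r0R ?Dl ?bD.
pose v := s ∘ c.
have v0 : v <> 0.
  move=> v0; case: Ss => S0 _; apply: S0; rewrite /is_zero; apply: sepi.
  by apply: (cokernel_epic ck); rewrite comp_idl !comp0l.
have vR a : a \in R -> v ∘ a = 0 by move=> aR; rewrite /v -compA cR ?comp0r.
(* Representatives modulo [R] of the basis dual to [b]. *)
have [|a aE] := @dependent_choice_ex 'I_(\dim D) (fun _ => A)
    (fun j x => forall l : 'I_(\dim D), t (x ∘ b`_l) = (l == j)%:R).
  move=> j; have [|x xE] := surj \id_G _ (fun l => (l == j)%:R).
    by exists b`_i0; rewrite ?bD // comp_idl t0; apply/eqP/oner_neq0.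
  by exists x => l; rewrite -xE comp_idl.
pose r (x : A) i l := coord b l (x ∘ b`_i).
have rE x i1 : x ∘ b`_i1 = \sum_l r x i1 l *: b`_l.
  exact/coord_vbasis/Dl.
exists S, (\dim D), (fun j => b`_j), (fun j => v ∘ a j), r; split=> //.
- exists i0; last by move=> j; apply/Dq/bD.
  by move=> b0; have /eqP := oner_neq0 k; apply; rewrite -t0 b0 /t linear0.
(* If [e j] is not 0, then [x] is not in [R], so [surj] makes some [x ∘ y] congruent to the identity
   modulo [R], and [v = v ∘ x ∘ y = 0]. *)
- move=> e ev j; apply: contrapT => ej; apply: v0.
  pose x := \sum_j e j *: a j.
  have [|y yE] := surj x _ (fun l : 'I_(\dim D) => t b`_l).
    exists b`_j => //; rewrite /x comp_suml tsum (bigD1 j) //= big1.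
      by rewrite addr0 compZl tZ aE eqxx mulr1.
    move=> l lj; rewrite compZl tZ aE eq_sym.
    by rewrite (negbTE lj) mulr0.
  have xyR : \id_G - (x ∘ y) \in R.
    by apply/RP => l; rewrite compBl comp_idl tB yE subrr.
  have := vR _ xyR; rewrite compBr comp_idr compA => /eqP.
  rewrite subr_eq0 => /eqP ->; rewrite /x comp_sumr.
  by under eq_bigr do rewrite compZr; rewrite ev comp0l.
(* Modulo [R] only the values of [t (- ∘ b_l)] matter, and both sides give [r x l j]. *)
- move=> x j; rewrite -compA.
  apply/eqP; rewrite -subr_eq0; apply/eqP.
  under [X in _ - X]eq_bigr do rewrite -compZr.
  rewrite -comp_sumr -compBr; apply: vR; apply/RP => l.
  rewrite compBl -compA rE comp_sumr comp_suml tB !tsum.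
  rewrite (bigD1 j) //= big1 => [|n1 n1j]; last first.
    by rewrite compZr tZ aE (negbTE n1j) mulr0.
  rewrite [X in _ - X](bigD1 l) //= [X in _ - (_ + X)]big1 => [|n1 n1l]; last
    first.
    by rewrite compZl tZ aE eq_sym (negbTE n1l) mulr0.
  rewrite compZr compZl !tZ !aE !eqxx.
  by rewrite !addr0 subrr.
Qed.

End Nakayama.

(** * Splitting of extensions *)

Section Splitting.
Variables (k : closedFieldType) (C : linearCategory k).
Hypothesis fin : finite_category C.
Implicit Types S T U V W X Y Z : C.

Let ab := finite_abelian fin.

(** A section [s] of [q] exists by projectivity; the monic [i] is a kernel, so [\id_X - (s ∘ q)]
    factors through it and yields a retraction [r]. The new summand [Q] gets index 0. *)
Lemma direct_sum_ext Y Q X (i : mor Y X) (q : mor X Q) n (S : 'I_n -> C) :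
  monic i -> is_cokernel i q -> projective Q -> is_direct_sum Y S ->
  is_direct_sum X (fun a => if unlift ord0 a is Some b then S b else Q).
Proof.
move=> mi cq Qp [j [p [pj pj0 jp]]]; have [qi0 qu] := cq.
have [s qs] := Qp _ _ _ \id_Q (cokernel_epic cq).
have [Z [g [gi0 gu]]] := monic_normal ab mi.
have [r [ir _]] : exists! r, i ∘ r = \id_X - (s ∘ q).
  apply: gu; have [h [<- _]] := qu _ g gi0.
  by rewrite compBr comp_idr !compA -[h ∘ q ∘ s]compA qs comp_idr subrr.
have ri : r ∘ i = \id_Y.
  by apply: mi; rewrite compA ir compBl comp_idl comp_idr -compA qi0 comp0r
    subr0.
have rs : r ∘ s = 0.
  by apply: mi; rewrite compA ir compBl comp_idl comp0r -compA qs comp_idr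
    subrr.
pose So o := if o is Some b then S b else Q.
pose I (o : option 'I_n) : mor (So o) X :=
  match o return mor (So o) X with Some b => i ∘ j b | None => s end.
pose P (o : option 'I_n) : mor X (So o) :=
  match o return mor X (So o) with Some b => p b ∘ r | None => q end.
exists (fun a => I (unlift ord0 a)), (fun a => P (unlift ord0 a)); split.
- move=> a; case: (unlift ord0 a) => [b|] //=.
  by rewrite !compA -(compA (p b)) ri comp_idr pj.
- move=> a a' aa'; have: unlift ord0 a <> unlift ord0 a'.
    move: aa'; case: unliftP => [b ->|->]; case: unliftP => [b' ->|->] // aa'.
    by case=> bb'; apply: aa'; rewrite bb'.
  case: (unlift ord0 a) (unlift ord0 a') => [b|] [b'|] //= bb'.
  + by rewrite !compA -(compA (p b)) ri comp_idr pj0 // => e; apply: bb';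
    rewrite e.
  + by rewrite -compA rs comp0r.
  + by rewrite compA qi0 comp0l.
pose F o := I o ∘ P o; rewrite -[LHS]/(\sum_a F (unlift ord0 a)).
rewrite big_ord_recl unlift_none; under eq_bigr do rewrite liftK.
rewrite /F /=; under eq_bigr do rewrite compA -(compA i).
by rewrite -comp_suml -comp_sumr jp comp_idr ir addrC subrK.
Qed.

Lemma projective_semisimple :
  (forall X, projective X) -> semisimple_category C.
Proof.
move=> allp X; elim: (finite_lengths fin X) => [Y Y0|Y Z Q i q mi cq Qs _ [n [S
  [Ss YS]]]].
  exists 0, (fun _ => Y); split; first by case.
  exists (fun _ => \id_Y), (fun _ => \id_Y).
  by split=> [[]//|[]//|]; rewrite big_ord0 Y0.
exists n.+1, (fun a => if unlift ord0 a is Some b then S b else Q).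
split; first by move=> a; case: (unlift ord0 a).
exact: direct_sum_ext cq (allp Q) YS.
Qed.

End Splitting.

(** * Projectivity of the unit and faithfulness of tensoring *)

Section UnitProjective.
Variables (k : closedFieldType) (C : rigidCategory k).
Implicit Types S T U V W X Y Z : C.

(** Lifting [f] along [e] amounts to lifting its adjunct [𝟙 → Z ⊗ X^∨] along [e ▷ X^∨], which is
    still epic. *)
Lemma unit_projective X : projective (𝟙 : C) -> projective X.
Proof.
move=> p1 Y Z e f eepi.
have [h hE] := p1 _ _ _ ((f ▷ X^∨) ∘ coev X) (epic_whr (A := X^∨) eepi).
exists (uncurry h ∘ lu' X).
rewrite compA comp_uncurry hE -comp_uncurry -[RHS]comp_idr -(zigzag X).
by rewrite /uncurry -lock !compA.
Qed.

Hypothesis fin : finite_category C.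
Hypothesis unit_simple : simple_object (𝟙 : C).

Let ab := finite_abelian fin.

(** [coev S] is non-zero, hence monic since [𝟙] is simple, and it embeds [f] into
    [f ▷ (S ⊗ S^∨)]. *)
Lemma whr_eq0 S X Y (f : mor X Y) : ~ is_zero S -> f ▷ S = 0 -> f = 0.
Proof.
move=> S0 fS; have coev0 : coev S <> 0.
  move=> c0; apply: S0; rewrite /is_zero -zigzag c0.
  by rewrite tensm0l comp0r comp0l.
apply: whr_unit_inj; rewrite tensm0l.
apply: (monic_whl (simple_monic ab unit_simple coev0)).
rewrite -exch comp0r -[RHS](comp0l _ (X ◁ coev S)); congr (_ ∘ _).
apply: (iso_mono' (i := assoc _ _ _)).
by rewrite assoc_nat1' fS tensm0l comp0l comp0r.
Qed.

End UnitProjective.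

(** * The criterion *)

Section Main.
Variables (k : closedFieldType) (C : ribbonCategory k).
Hypothesis fin : finite_category C.
Hypothesis unit_simple : simple_object (𝟙 : C).
Variable L : coend C.
Hypothesis nondeg : nondegenerate_pairing (cpairing L).
Variable Lam : mor 𝟙 L.
Hypothesis Lam_integral : cmul L ∘ (Lam ▷ L) = Lam ∘ ccounit L ∘ lu L.
Hypothesis Lam_neq0 : Lam <> 0.
Implicit Types S T U V W X Y Z : C.

Let ab := finite_abelian fin.

Let Q X : mor X X := loop (fun X Z => bwd (dbraid X Z)) Lam X.

Let Q_nat X Y (f : mor X Y) : Q Y ∘ f = f ∘ Q X.
Proof. exact: (loop_nat (@dbraid_nat' _ C)). Qed.

Let Q_dinatural V (phi : forall X : C, mor (X^∨ ⊗ X) V) Z :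
  dinatural phi ->
  phi Z ∘ (Z^∨ ◁ Q Z)
  = phi 𝟙 ∘ (coev_unit C ▷ 𝟙) ∘ lu' 𝟙 ∘ (ev Z ∘ (Z^∨ ◁ Q Z)).
Proof. exact: cointegral_dinatural. Qed.

(** Supplies test families for [Q_dinatural]: [Q] itself, and later the projection onto the isotypic
    part of the unit. *)
Lemma ev_dinatural (h : forall X : C, mor X X) :
  (forall X Y (f : mor X Y), h Y ∘ f = f ∘ h X) ->
  dinatural (fun X => ev X ∘ (X^∨ ◁ h X)).
Proof.
move=> hn X Y f; rewrite (comp2 (esym (exch _ _))) !compA ev_dualm.
by rewrite -!compA -!whl_comp hn.
Qed.

(* By naturality of coevaluation, an A-invariant pairing on a generator G, with
   A = End G, is the same as a natural map on G, which extends to C. *)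
Lemma dinatural_extension G V (psi : mor (G^∨ ⊗ G) V) :
  separator G ->
  (forall f : mor G G, psi ∘ (dualm f ▷ G) = psi ∘ (G^∨ ◁ f)) ->
  exists phi : forall X, mor (X^∨ ⊗ X) V, dinatural phi /\ phi G = psi.
Proof.
move=> Gs psid; pose a := (G ◁ psi) ∘ coevA G G.
have [|b [bn bG]] := natural_extension (V := V) fin (a := a) Gs.
  move=> f; rewrite /a -compA -coevA_nat compA -whl_comp -psid.
  by rewrite whl_comp -compA coevA_dualm !compA exch.
exists (fun X => evA X V ∘ (X^∨ ◁ b X)); split.
  move=> X Y f; rewrite (comp2 (esym (exch _ _))) !compA evA_dualm.
  by rewrite -!compA -!whl_comp bn.
by rewrite bG /a whl_comp compA evA_nat -compA zigzagA_dual comp_idr.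
Qed.

Lemma unit_splits : ccounit L ∘ Lam <> 0 -> projective (𝟙 : C).
Proof.
move=> eL; have [G [Gp Gs]] := projective_separator_ex fin.
have kap0 : ev (𝟙 : C) ∘ (𝟙^∨ ◁ Q 𝟙) ∘ (coev_unit C ▷ 𝟙) ∘ lu' 𝟙 <> 0.
  rewrite /Q loopm_unit => kap0; apply: eL; apply: whr_unit_inj.
  apply: (iso_mono (i := lunit 𝟙)); apply: (iso_epi' (i := lunit 𝟙)).
  by rewrite kap0 tensm0l comp0r comp0l.
have [c kapE] := schur ab (ev 𝟙 ∘ (𝟙^∨ ◁ Q 𝟙) ∘ (coev_unit C ▷ 𝟙) ∘ lu' 𝟙)
  unit_simple.
have c0 : c != 0 by apply/eqP => c0; apply: kap0; rewrite kapE c0 scale0r.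
(* For the test family built from [Q], the value on the unit is [c]. *)
have QQ X : Q X ∘ Q X = c *: Q X.
  apply: ev_inj_r; have := Q_dinatural X (ev_dinatural Q_nat).
  by rewrite kapE compZl comp_idl whl_comp compA => ->; rewrite tensmZr compZr.
have [e e0] : exists e : mor G 𝟙, e <> 0.
  apply: contrapT => no; case: unit_simple => u0 _; apply: u0; apply: Gs => h.
  by apply: contrapT => h0; apply: no; exists h; rewrite -[h]comp_idl.
have Q1 : Q 𝟙 <> 0.
  by move=> Q1; apply: kap0; rewrite Q1 tensm0r comp0r !comp0l.
have eQ : e ∘ Q G <> 0.
  rewrite -Q_nat => Qe; apply: Q1; apply: (simple_epic ab unit_simple e0).
  by rewrite Qe comp0l.
have QG : Q G <> 0 by move=> QG; apply: eQ; rewrite QG comp0r.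
have [S [m [d [v [r [Ss [i0 di0 dQ] vfree dr vr]]]]]] :=
  simple_dual_ex fin Gp QG (fun a => Q_nat a).
(* The canonical element of [D] tensored with its dual; it is invariant because [d] and [v]
   transform by transposed matrices. *)
pose psi := \sum_i (dualm (d i) ⊗m v i).
have psid (f : mor G G) : psi ∘ (dualm f ▷ G) = psi ∘ (G^∨ ◁ f).
  rewrite /psi !comp_suml.
  transitivity (\sum_i \sum_l r f i l *: (dualm (d l) ⊗m v i)).
    apply: eq_bigr => i _; rewrite -tensm_comp comp_idr -dualm_comp dr.
    rewrite dualm_sum tensm_suml; apply: eq_bigr => l _.
    by rewrite dualmZ tensmZl.
  rewrite exchange_big; apply: eq_bigr => l _ /=.
  rewrite -tensm_comp comp_idr vr tensm_sumr; apply: eq_bigr => i _.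
  by rewrite tensmZr.
have [phi [phid phiG]] := dinatural_extension Gs psid.
have psiQ : psi ∘ (G^∨ ◁ Q G) = c *: psi.
  rewrite -psid /psi comp_suml scaler_sumr; apply: eq_bigr => i _.
  rewrite -tensm_comp comp_idr -dualm_comp; have [b ->] := dQ i.
  by rewrite compA QQ compZl dualmZ tensmZl.
have := Q_dinatural G phid; rewrite phiG psiQ.
set tau := _ ∘ lu' 𝟙 => tauE.
(* Transposing [G^∨] turns [psi] into the sum of the [g i ∘ v i]; the [v i] are jointly epic, so
   [psi = 0] would force [g i0 = 0] and then [d i0 = 0]. *)
have psi0 : psi <> 0.
  move=> psi0; apply: di0; apply: dualm_eq0.
  apply: (whr_eq0 fin unit_simple (S := S)); first by case: Ss.
  pose g i := (G ◁ (dualm (d i) ▷ S)) ∘ coevA G S.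
  have gi0 : g i0 = 0.
    apply: (simple_joint_epic ab Ss vfree).
    transitivity ((G ◁ psi) ∘ coevA G G); last by rewrite psi0 tensm0r comp0l.
    rewrite /psi tensm_sumr comp_suml; apply: eq_bigr => i _.
    by rewrite /g -compA -coevA_nat compA -whl_comp whrl.
  rewrite -[LHS]comp_idr -zigzagA_dual compA -evA_nat -compA -whl_comp.
  by rewrite -/(g i0) gi0 tensm0r comp0r.
have tau0 : tau <> 0.
  move=> tau0; apply: psi0; apply/eqP; move/eqP: tauE.
  by rewrite tau0 comp0l scaler_eq0 (negbTE c0).
(* By [tauE], [tau ∘ ev ∘ (id ⊗ Q)] is a multiple of [psi], and [tau] is monic as [𝟙] is simple. *)
have kill U (u : mor U G) : (forall i, v i ∘ u = 0) -> Q G ∘ u = 0.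
  move=> vu; apply: ev_inj_r; rewrite tensm0r comp0r.
  apply: (simple_monic ab unit_simple tau0); rewrite comp0r whl_comp !compA.
  rewrite -[tau ∘ _ ∘ _]compA -tauE compZl /psi comp_suml big1 ?scaler0 // => i
    _.
  by rewrite -tensm_comp vu tensm0r.
have [T [i [p [pi pi0 ip]]]] := direct_sum_ex ab (fun _ : 'I_m => S).
pose w := \sum_a (i a ∘ v a).
have pw a : p a ∘ w = v a.
  rewrite /w comp_sumr (bigD1 a) //= compA pi comp_idl big1 ?addr0 // => b ba.
  by rewrite compA pi0 ?comp0l // => ab'; rewrite ab' eqxx in ba.
have wepi : epic w.
  apply: epicP => Z u uw; rewrite -[u]comp_idr -ip comp_sumr big1 // => a _.
  rewrite compA (simple_joint_epic ab Ss vfree (g := fun a => u ∘ i a)) ?comp0l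
    //.
  by rewrite -[RHS]uw /w comp_sumr; apply: eq_bigr => b _; rewrite compA.
(* The epimorphism [w] onto a power of [S] is a cokernel, so [kill] makes [Q G] factor through
   it. *)
have [W [z [wz wu]]] := epic_conormal ab wepi.
have [|q [qE _]] := wu _ (Q G).
  by apply: kill => a; rewrite -pw -compA wz comp0r.
have [a ea] : exists a, e ∘ q ∘ i a <> 0.
  apply: contrapT => no; apply: eQ; rewrite -qE /w !comp_sumr big1 // => a _.
  rewrite !compA; have -> : e ∘ q ∘ i a = 0; last by rewrite comp0l.
  by apply: contrapT => ea; apply: no; exists a.
have [j jE] := simple_iso ab Ss unit_simple ea.
(* Now [q ∘ i a ∘ bwd j] is a section of [e], so [𝟙] is a retract of the projective [G]. *)
move=> Y Z x f xepi; have [g gE] := Gp _ _ x (f ∘ e) xepi.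
exists (g ∘ (q ∘ i a ∘ bwd j)).
by rewrite compA gE -compA !compA -(compA f) -(compA f) -jE -compA bwdK
  comp_idr.
Qed.

(** [f] projects onto the summands isomorphic to [𝟙]. In a semisimple category the two recorded
    properties determine it, which later yields naturality in [X]. *)
Lemma unit_isotypic_ex : semisimple_category C -> forall X, exists f : mor X X,
  (forall h : mor X 𝟙, h ∘ f = h) /\
  (forall S (g : mor X S), simple_object S -> ~ inhabited (iso S 𝟙) -> g ∘ f =
    0).
Proof.
move=> ss X; have [n [S [Ss [i [p [pi pi0 ip]]]]]] := ss X.
exists (\sum_(a | `[<inhabited (iso (S a) 𝟙)>]) (i a ∘ p a)); split=> [h|T g Ts
  T1].
  rewrite -[RHS]comp_idr -ip.
  rewrite [in RHS](bigID (fun a => `[<inhabited (iso (S a) 𝟙)>])) /=.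
  rewrite compDr [X in _ + X]comp_sumr [X in _ + X]big1 ?addr0 // => a /asboolP
    na.
  rewrite compA; have -> : h ∘ i a = 0; last by rewrite comp0l.
  apply: contrapT => ha; apply: na.
  by have [j _] := simple_iso ab (Ss a) unit_simple ha.
rewrite comp_sumr big1 // => a /asboolP [j].
rewrite compA; have -> : g ∘ i a = 0; last by rewrite comp0l.
apply: contrapT => ga; apply: T1; have [l _] := simple_iso ab (Ss a) Ts ga.
constructor; exists (fwd j ∘ bwd l) (fwd l ∘ bwd j).
  by rewrite !compA fwdKr bwdK.
by rewrite !compA fwdKr bwdK.
Qed.

Lemma counit_integral_neq0 : semisimple_category C -> ccounit L ∘ Lam <> 0.
Proof.
move=> ss eL.
have [S [Ss QS]] : exists S, simple_object S /\ Q S <> 0.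
  have [X QX] := loopm_neq0 nondeg Lam_neq0.
  have [n [S [Ss [i [p [pi pi0 ip]]]]]] := ss X.
  apply: contrapT => no; apply: QX; rewrite -[LHS]comp_idr -ip comp_sumr big1
    // => a _.
  rewrite compA (Q_nat (i a)); have -> : Q (S a) = 0; last by rewrite comp0r
    comp0l.
  by apply: contrapT => Qa; apply: no; exists (S a).
have [pr prE] := dependent_choice_ex (unit_isotypic_ex ss).
(* Compared on each simple summand of [Y]: on copies of [𝟙] both projections act as the identity, on
   the others both give 0. *)
have pr_nat X Y (t : mor X Y) : pr Y ∘ t = t ∘ pr X.
  have [n [T [Ts [i [p [pi pi0 ip]]]]]] := ss Y.
  rewrite -[LHS]comp_idl -[RHS]comp_idl -ip !comp_suml; apply: eq_bigr => a _.
  rewrite -!compA; congr (_ ∘ _); rewrite !compA.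
  case: (pselect (inhabited (iso (T a) 𝟙))) => [[j]|na].
    apply: (iso_mono (i := j)); rewrite !compA.
    by rewrite (prE Y).1 (prE X).1.
  by rewrite (prE Y).2 // comp0l (prE X).2.
have Q1 : Q 𝟙 <> 0.
  case: (pselect (inhabited (iso S 𝟙))) => [[j] Q1|nS].
    by apply: QS; apply: (iso_mono (i := j)); rewrite -Q_nat Q1 comp0l comp0r.
  exfalso; apply: QS; apply: ev_inj_r.
  (* The family built from [pr] vanishes at [S], but its value on the unit is the identity, so
     [ev ∘ (id ⊗ Q)] vanishes at [S]. *)
  have := Q_dinatural S (ev_dinatural pr_nat).
  rewrite -[pr S]comp_idl (prE S).2 // -[pr 𝟙]comp_idl (prE 𝟙).1.
  by rewrite !tensm0r tensm_id !comp_idr ev_unit bwdK comp_idl comp0r comp0l.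
have := loopm_unit Lam; rewrite eL tensm0l comp0r comp0l.
have [c cE] := schur ab (Q 𝟙) unit_simple.
rewrite -/(Q 𝟙) cE tensmZr tensm_id compZr comp_idr !compZl ev_unit bwdK.
move/eqP; rewrite scaler_eq0 => /orP [/eqP c0|/eqP id0].
  by apply: Q1; rewrite cE c0 scale0r.
by case: unit_simple.
Qed.

(** Constant colourings already determine the morphism of the opened unknot, since the [cj L X] are
    jointly epic; the counit satisfies the equation, so the default 0 of [xget] does not occur. *)
Lemma link_unknotE :
  link_morphism L S2xS1 ∘ integral_pow Lam 1
  = ccounit L ∘ Lam ∘ ru 𝟙 ∘ lu' 𝟙.
Proof.
have -> : link_morphism L S2xS1 = ccounit L ∘ ru L.
  rewrite /link_morphism; case: xgetP => [f _ fE|no]; last first.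
    exfalso; apply: (no (ccounit L ∘ ru L)) => X /=.
    by rewrite -compA runit_nat compA ccounitE.
  apply: (iso_epi' (i := runit L)); rewrite bwdKr; apply: cj_epi => X.
  rewrite ccounitE -compA runit_nat' compA.
  have := fE (fun _ => X); rewrite /= => ->.
  by rewrite bwdKr.
by rewrite /= compA -(compA (ccounit L)) runit_nat !compA.
Qed.

End Main.

Theorem proposition3p13 (k : closedFieldType) (C : ribbonCategory k)
  (C_finite : finite_tensor_category C)
  (L : coend C) (C_modular : nondegenerate_pairing (cpairing L))
  (Lam : mor (tunit C) L) (Lam_neq0 : Lam <> 0)
  (Lam_integral : two_sided_integral Lam)
  (Dp Dm D : k)
  (Dp_def : ccounit L ∘ fwd (ctwist L) ∘ Lam = Dp *: idm (tunit C))
  (Dm_def : ccounit L ∘ bwd (ctwist L) ∘ Lam = Dm *: idm (tunit C))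
  (D_sqr : D ^+ 2 = Dp * Dm) :
  lyubashenko Lam D (Dp / D) S2xS1 <> 0 <-> semisimple_category C.
Proof.
case: C_finite => fin unit_simple; case: Lam_integral => Lam_int _.
rewrite /lyubashenko link_unknotE; split=> [lyu|ss].
  apply: (projective_semisimple fin) => X; apply: unit_projective.
  apply: (unit_splits fin unit_simple C_modular Lam_int) => eL.
  by apply: lyu; rewrite eL !comp0l scaler0.
(* Both framed unknots being non-zero, so are [D] and the normalising scalar, which can be
   cancelled. *)
have Dp0 := framed_unknot_neq0 C_modular Lam_int Lam_neq0 Dp_def.
have Dm0 := framed_unknot_neq0' C_modular Lam_int Lam_neq0 Dm_def.
have D0 : D != 0 by rewrite -sqrf_eq0 D_sqr mulf_neq0.
have scal0 : D ^- (ncomp S2xS1).+1 * (Dp / D) ^ (- link_signature S2xS1) != 0.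
  by rewrite mulf_neq0 ?invr_eq0 ?expf_neq0 ?expfz_neq0 ?mulf_neq0 ?invr_eq0.
move/eqP; rewrite scaler_eq0 (negbTE scal0) => /eqP e0.
apply: (counit_integral_neq0 fin unit_simple C_modular Lam_int Lam_neq0 ss).
apply: (iso_epi (i := runit 𝟙)); apply: (iso_epi' (i := lunit 𝟙)).
by rewrite e0 !comp0l.
Qed.
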